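(* Let $n>m\ge3$. Let $R$ be a commutative ring such that $\mathrm{SL}_k(R)$ is generated by elementary matrices for all $k\ge1$, and such that the natural map $K_2(3,R)\to K_2(n,R)$ is surjective. Then $\mathcal{T}_{n,m}(R)$ is simply connected.
   Context: A flag in $R^n$ is a chain $0\subsetneq V_1\subsetneq\cdots\subsetneq V_k\subsetneq R^n$ of free direct summands; complete if $k=n-1$, good if a subflag of a complete flag. The Tits complex $\mathcal{T}_n(R)$ has vertices the direct summands $V$ of $R^n$, $0\ne V\ne R^n$, with $V$ and $R^n/V$ free, and a $k$-simplex for every good flag with $k+1$ terms. $\mathcal{T}_{n,m}(R)$ is the full subcomplex on vertices of rank $\le m$. Elementary matrices $e_{ij}(\lambda)$ ($i\ne j$) agree with the identity except for $\lambda$ in position $(i,j)$; $E_n(R)$ is the group they generate. The Steinberg group $S_n(R)$ ($n\ge3$) is generated by symbols $x_{ij}(\lambda)$ subject to $x_{ij}(\lambda)x_{ij}(\mu)=x_{ij}(\lambda+\mu)$ and $[x_{ij}(\lambda),x_{k\ell}(\mu)]=1$ if $j\ne k,i\ne\ell$; $=x_{i\ell}(\lambda\mu)$ if $j=k,i\ne\ell$; $=x_{kj}(-\mu\lambda)$ if $j\ne k,i=\ell$. $K_2(n,R)=\ker(S_n(R)\to E_n(R))$, $x_{ij}(\lambda)\mapsto e_{ij}(\lambda)$, and $K_2(3,R)\to K_2(n,R)$ is induced by $x_{ij}(\lambda)\mapsto x_{ij}(\lambda)$. *)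

(* Defs.v *)
From mathcomp Require Import all_boot all_order all_algebra.
Set Implicit Arguments. Unset Strict Implicit. Unset Printing Implicit Defensive.
Import GRing.Theory.
Local Open Scope ring_scope.

(* Generic: combinatorial simple connectivity of a simplicial complex *)
(* given by a predicate on finite lists of vertices (a list spans a   *)
(* simplex; repetitions allowed).  Simple connectivity is expressed    *)
(* through the edge-path groupoid (Spanier), which computes pi_1 of    *)
(* the geometric realization.                                          *)
Section SimplyConnected.
Variable T : Type.
Variable Simp : seq T -> Prop.

Definition is_vertex (v : T) := Simp [:: v].

Fixpoint edge_path (p : seq T) : Prop :=
  match p with
  | [::] => False
  | [:: v] => Simp [:: v]
  | u :: ((v :: _) as q) => Simp [:: u; v] /\ edge_path q
  end.

Inductive ep_equiv : seq T -> seq T -> Prop :=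
  | ep_refl p : ep_equiv p p
  | ep_sym p q : ep_equiv p q -> ep_equiv q p
  | ep_trans p q r : ep_equiv p q -> ep_equiv q r -> ep_equiv p r
  | ep_stutter p q u : Simp [:: u] ->
      ep_equiv (p ++ [:: u; u] ++ q) (p ++ [:: u] ++ q)
  | ep_move p q u v w : Simp [:: u; v; w] ->
      ep_equiv (p ++ [:: u; v; w] ++ q) (p ++ [:: u; w] ++ q).

Definition simply_connected : Prop :=
  (exists v, is_vertex v) /\
  (forall u v, is_vertex u -> is_vertex v ->
     exists p, edge_path (u :: p) /\ last u p = v) /\
  (forall v p, edge_path (v :: p) -> last v p = v ->
     ep_equiv (v :: p) [:: v]).

End SimplyConnected.

Section Tits.
Variable R : comNzRingType.

Definition subset_of (n : nat) := 'rV[R]_n -> Prop.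

Definition is_submodule n (V : subset_of n) :=
  V 0 /\ (forall x y, V x -> V y -> V (x + y)) /\
  (forall (a : R) x, V x -> V (a *: x)).

Definition lincomb n k (c : 'I_k -> R) (b : 'I_k -> 'rV[R]_n) : 'rV[R]_n :=
  \sum_(i < k) c i *: b i.

Definition is_basis_of n (V : subset_of n) k (b : 'I_k -> 'rV[R]_n) :=
  (forall i, V (b i)) /\
  (forall v, V v -> exists c, v = lincomb c b) /\
  (forall c, lincomb c b = 0 -> forall i, c i = 0).

Definition is_free n (V : subset_of n) :=
  is_submodule V /\ exists k (b : 'I_k -> 'rV[R]_n), is_basis_of V b.

(* V free of rank <= m (rank is well defined over a nonzero commutative ring) *)
Definition rank_le n (V : subset_of n) (m : nat) :=
  exists k (b : 'I_k -> 'rV[R]_n), (k <= m)%N /\ is_basis_of V b.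

Definition direct_summand n (V : subset_of n) :=
  is_submodule V /\
  exists W : subset_of n, is_submodule W /\
    (forall x, V x -> W x -> x = 0) /\
    (forall x, exists y z, V y /\ W z /\ x = y + z).

(* R^n / V is free: some family w whose images form a basis of R^n / V *)
Definition quotient_free n (V : subset_of n) :=
  exists l (w : 'I_l -> 'rV[R]_n),
    (forall x, exists c y, V y /\ x = lincomb c w + y) /\
    (forall c, V (lincomb c w) -> forall i, c i = 0).

Definition nonzero_sub n (V : subset_of n) := exists x, V x /\ x <> 0.
Definition proper_sub n (V : subset_of n) := exists x, ~ V x.

Definition tits_vertex n (V : subset_of n) :=
  direct_summand V /\ nonzero_sub V /\ proper_sub V /\
  is_free V /\ quotient_free V.

Definition complete_flag n (F : 'I_n.-1 -> subset_of n) :=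
  (forall i, direct_summand (F i) /\ is_free (F i)) /\
  (forall i j : 'I_n.-1, (i < j)%N ->
      (forall x, F i x -> F j x) /\ exists x, F j x /\ ~ F i x) /\
  (forall i, nonzero_sub (F i)) /\ (forall i, proper_sub (F i)).

Fixpoint in_list (T : Type) (x : T) (s : seq T) : Prop :=
  match s with [::] => False | y :: s' => x = y \/ in_list x s' end.

Definition tits_simplex n m (S : seq (subset_of n)) :=
  (forall V, in_list V S -> tits_vertex V /\ rank_le V m) /\
  exists F : 'I_n.-1 -> subset_of n, complete_flag F /\
    forall V, in_list V S -> exists i, V = F i.

Definition elem_mx n (i j : 'I_n) (l : R) : 'M[R]_n :=
  1%:M + l *: delta_mx i j.

(* letters x_ij(l) and their formal inverses (st_inv = true) *)
Record stletter (n : nat) := StL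
  { st_i : 'I_n; st_j : 'I_n; st_l : R; st_inv : bool }.

Definition xl n (i j : 'I_n) (l : R) := StL i j l false.
Definition stinv n (a : stletter n) := StL (st_i a) (st_j a) (st_l a) (~~ st_inv a).
Definition comm_word n (a b : stletter n) := [:: a; b; stinv a; stinv b].

Definition valid_word n (w : seq (stletter n)) :=
  all (fun a => st_i a != st_j a) w.

Definition letter_mx n (a : stletter n) : 'M[R]_n :=
  if st_inv a then elem_mx (st_i a) (st_j a) (- st_l a)
  else elem_mx (st_i a) (st_j a) (st_l a).

Definition word_mx n (w : seq (stletter n)) : 'M[R]_n :=
  foldr (fun a M => letter_mx a *m M) 1%:M w.

Definition SL_elementary :=
  forall k : nat, (1 <= k)%N -> forall A : 'M[R]_k, \det A = 1 ->
    exists w : seq (stletter k), valid_word w /\ word_mx w = A.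

(* Steinberg group S_n(R): words modulo the congruence generated by the
   free-group relations and the Steinberg relations ([a,b] = a b a^-1 b^-1) *)
Inductive st_eq n : seq (stletter n) -> seq (stletter n) -> Prop :=
  | st_refl w : st_eq w w
  | st_sym w w' : st_eq w w' -> st_eq w' w
  | st_trans w1 w2 w3 : st_eq w1 w2 -> st_eq w2 w3 -> st_eq w1 w3
  | st_ctx u v w w' : st_eq w w' -> st_eq (u ++ w ++ v) (u ++ w' ++ v)
  | st_free1 a : st_eq [:: a; stinv a] [::]
  | st_free2 a : st_eq [:: stinv a; a] [::]
  | st_add (i j : 'I_n) l mu : i != j ->
      st_eq [:: xl i j l; xl i j mu] [:: xl i j (l + mu)]
  | st_comm1 (i j k l : 'I_n) a b : i != j -> k != l -> j != k -> i != l ->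
      st_eq (comm_word (xl i j a) (xl k l b)) [::]
  | st_comm2 (i j l : 'I_n) a b : i != j -> j != l -> i != l ->
      st_eq (comm_word (xl i j a) (xl j l b)) [:: xl i l (a * b)]
  | st_comm3 (i j k : 'I_n) a b : i != j -> k != i -> j != k ->
      st_eq (comm_word (xl i j a) (xl k i b)) [:: xl k j (- (b * a))].

Definition embed_letter n (H : (3 <= n)%N) (a : stletter 3) : stletter n :=
  StL (widen_ord H (st_i a)) (widen_ord H (st_j a)) (st_l a) (st_inv a).

(* the natural map K_2(3,R) -> K_2(n,R) is surjective: every element of
   K_2(n,R) (a word with trivial image in E_n(R)) is equal in S_n(R) to the
   image of an element of K_2(3,R) *)
Definition K2_3_surj (n : nat) :=
  forall H : (3 <= n)%N, forall w : seq (stletter n),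
    valid_word w -> word_mx w = 1%:M ->
    exists w' : seq (stletter 3),
      valid_word w' /\ word_mx w' = 1%:M /\ st_eq w (map (embed_letter H) w').

End Tits.

(* Main.v *)
(* T_{n,m} carries an action of SL_n with a simplex as fundamental domain, whose
   vertex stabilisers are the parabolics P_1, ..., P_m, so its fundamental group
   is the kernel of G -> SL_n, where G is the amalgam of the P_k along their
   intersections.  Here G is realised as words in the P_k up to homotopy of the
   edge paths they describe.  The Steinberg group maps to G: x_ij goes to e_ij in
   any P_k containing it, and the remaining x_1j (j > m) go to commutators.  This
   map is onto because SL_k is generated by elementary matrices.  An element
   of the kernel of G -> SL_n therefore comes from K_2(n,R), hence from K_2(3,R);
   but the letters of S_3 all land in the single parabolic P_3, as 3 <= m, where a
   word is determined by its matrix.  So the kernel is trivial.  Indices start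
   at 0 in the code. *)
Require Import Defs.
From HB Require Import structures.
From mathcomp Require Import all_boot all_order all_algebra zify generic_quotient.
From mathcomp Require Import boolp.
Set Implicit Arguments. Unset Strict Implicit. Unset Printing Implicit Defensive.
Import GRing.Theory.
Local Open Scope ring_scope.

(** * Elementary matrices and parabolic subgroups *)

(** The obstacle in mapping the Steinberg group to G is that the root elements e_{0j} with j >= m
    lie in no parabolic, so the relations in which they occur cannot be read off in one P_k. They
    are derived by commutator calculus through a middle index 0 < a < m. Two such indices, 1 and 2,
    are needed to show that the commutator standing for e_{0j} does not depend on a and sees only
    the product of its two coefficients; so m >= 3 is used here as well as for P_3.

    That a simplex is a fundamental domain also takes an argument. A complete flag is only required
    to consist of free summands, so its successive quotients are a priori just stably free of rank
    one. Over a commutative ring such modules are free; this gives a basis of R^n adapted to the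
    flag, and rescaling one basis vector brings its determinant to 1.

    No presentation theorem for groups acting on complexes is invoked: each edge path ending at the
    base vertex is deformed into the path of a word in the parabolics, and two such paths with the
    same start are compared through injectivity of G -> SL_n. *)

Section ElementaryMatrices.
Variables (R : comNzRingType) (n : nat).
Implicit Types (i j p q l : 'I_n) (k : nat) (a b : R) (g h : 'M[R]_n).

Lemma delta_mul0 (p q : nat) j (k : 'I_n) (s : 'I_p) (t : 'I_q) : j != k ->
  delta_mx s j *m delta_mx k t = 0 :> 'M[R]_(p, q).
Proof. exact: mul_delta_mx_0. Qed.

Lemma mul_elem_mxl i j a (p : nat) (A : 'M[R]_(n, p)) :
  elem_mx i j a *m A = A + a *: (delta_mx i j *m A).
Proof. by rewrite /elem_mx mulmxDl mul1mx -scalemxAl. Qed.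

Lemma mul_elem_mxr i j a (p : nat) (A : 'M[R]_(p, n)) :
  A *m elem_mx i j a = A + a *: (A *m delta_mx i j).
Proof. by rewrite /elem_mx mulmxDr mulmx1 -scalemxAr. Qed.

Lemma elem_mx0 i j : elem_mx i j 0 = 1%:M :> 'M[R]_n.
Proof. by rewrite /elem_mx scale0r addr0. Qed.

Lemma elem_mxD i j a b : i != j ->
  elem_mx i j a *m elem_mx i j b = elem_mx i j (a + b).
Proof.
move=> ij; rewrite mul_elem_mxl /elem_mx mulmxDr mulmx1 -scalemxAr.
by rewrite delta_mul0 1?eq_sym // scaler0 addr0 scalerDl addrA addrAC.
Qed.

Lemma elem_mxC i j p l a b : j != p -> i != l ->
  elem_mx i j a *m elem_mx p l b = elem_mx p l b *m elem_mx i j a.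
Proof.
move=> jk il; rewrite !mul_elem_mxl /elem_mx !mulmxDr !mulmx1 -!scalemxAr.
by rewrite (delta_mul0 _ _ jk) delta_mul0 1?eq_sym // !scaler0 !addr0 addrAC.
Qed.

Lemma elem_mx_comm i j l a b : i != j -> j != l -> i != l ->
  elem_mx i j a *m elem_mx j l b =
  elem_mx i l (a * b) *m (elem_mx j l b *m elem_mx i j a).
Proof.
move=> ij jl il; have [li lj] : l != i /\ l != j by rewrite ![l == _]eq_sym.
rewrite [RHS]mul_elem_mxl [delta_mx i l *m _]mulmxA.
rewrite [delta_mx i l *m _]mul_elem_mxr (delta_mul0 _ _ lj) scaler0 addr0.
rewrite [delta_mx i l *m _]mul_elem_mxr (delta_mul0 _ _ li) scaler0 addr0.
rewrite !mul_elem_mxl /elem_mx !mulmxDr !mulmx1 -!scalemxAr.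
rewrite mul_delta_mx (delta_mul0 _ _ li) scaler0 addr0 scalerDr scalerA.
by rewrite !addrA; congr (_ + _); rewrite addrAC.
Qed.

Lemma det_elem_mx i j a : i != j -> \det (elem_mx i j a) = 1.
Proof.
have det_lower i' j' : (j' < i')%N -> \det (elem_mx i' j' a) = 1.
  move=> lt_ji; rewrite det_trig.
    rewrite big1 // => k _; rewrite !mxE eqxx.
    case: eqP => [->|]; case: eqP => [e|] //=; rewrite ?mulr0 ?addr0 //.
    by rewrite e ltnn in lt_ji.
  apply/is_trig_mxP => k l lt_kl; rewrite !mxE.
  rewrite (_ : k == l = false) ?add0r; last by apply/eqP => e; rewrite e ltnn in lt_kl.
  case: eqP => [e|_]; last by rewrite mulr0.
  case: eqP => [e'|_]; last by rewrite mulr0.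
  by rewrite e e' ltnNge ltnW in lt_kl.
move=> ij; case: (ltngtP i j) => [lt_ij|/det_lower//|/ord_inj e]; last first.
  by rewrite e eqxx in ij.
rewrite -det_tr /elem_mx linearD linearZ /= trmx_delta trmx1.
exact: det_lower.
Qed.

Lemma adj_unique g h : \det g = 1 -> g *m h = 1%:M -> \adj g = h.
Proof.
by move=> dg gh; rewrite -[LHS]mulmx1 -gh mulmxA mul_adj_mx dg mul1mx.
Qed.

Lemma mul_adjV g : \det g = 1 -> \adj g *m g = 1%:M.
Proof. by rewrite mul_adj_mx => ->. Qed.

Lemma mul_mxV g : \det g = 1 -> g *m \adj g = 1%:M.
Proof. by rewrite mul_mx_adj => ->. Qed.

Lemma adj_mul g h : \det g = 1 -> \det h = 1 ->
  \adj (g *m h) = \adj h *m \adj g.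
Proof.
move=> dg dh; apply: adj_unique; first by rewrite det_mulmx dg dh mulr1.
by rewrite mulmxA -(mulmxA g) mul_mxV // mulmx1 mul_mxV.
Qed.

Lemma det_adj1 g : \det g = 1 -> \det (\adj g) = 1.
Proof.
by move=> dg; rewrite -[LHS]mulr1 -[X in _ * X]dg -det_mulmx mul_adjV // det1.
Qed.

Lemma adj_adj1 g : \det g = 1 -> \adj (\adj g) = g.
Proof. by move=> dg; apply: adj_unique; [apply: det_adj1|apply: mul_adjV]. Qed.

Lemma adj_1 : \adj (1%:M : 'M[R]_n) = 1%:M.
Proof. by apply: adj_unique; rewrite ?det1 ?mulmx1. Qed.

Lemma adj_elem_mx i j a : i != j -> \adj (elem_mx i j a) = elem_mx i j (- a).
Proof.
move=> ij; apply: adj_unique; first exact: det_elem_mx.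
by rewrite elem_mxD // addrN elem_mx0.
Qed.

Definition corner0 (k : nat) g :=
  [forall i : 'I_n, forall j : 'I_n, (i < k <= j)%N ==> (g i j == 0)].

Lemma corner0P k g :
  reflect (forall i j : 'I_n, (i < k)%N -> (k <= j)%N -> g i j = 0) (corner0 k g).
Proof.
apply: (iffP forallP) => [H i j ik kj|H i].
  by have /forallP/(_ j) := H i; rewrite ik kj => /eqP.
by apply/forallP => j; apply/implyP => /andP[ik kj]; apply/eqP/H.
Qed.

Lemma corner0M k g h : corner0 k g -> corner0 k h -> corner0 k (g *m h).
Proof.
move=> /corner0P Hg /corner0P Hh; apply/corner0P => i j ik kj; rewrite mxE.
apply: big1 => l _; case: (ltnP l k) => lk; first by rewrite (Hh l) ?mulr0.
by rewrite (Hg _ l) ?mul0r.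
Qed.

Lemma corner0_1 k : corner0 k 1%:M.
Proof.
apply/corner0P => i j ik kj; rewrite mxE; case: eqP => // e.
by rewrite e ltnNge kj in ik.
Qed.

Lemma corner0_elem k i j a : ~~ (i < k <= j)%N -> corner0 k (elem_mx i j a).
Proof.
move=> H; apply/corner0P => p q pk kq; rewrite /elem_mx mxE.
rewrite (corner0P _ _ (corner0_1 k)) // add0r !mxE.
case: eqP => [e|]; case: eqP => [e'|] /=; rewrite ?mulr0 //.
by rewrite -e -e' pk kq in H.
Qed.

(* The stabiliser in SL_n of the span of the first k basis row vectors,
   acting on the right.  Over a ring without chosen inverses, the inverse of a
   matrix of determinant 1 is its adjugate. *)
Definition parabolic k g := [&& \det g == 1, corner0 k g & corner0 k (\adj g)].

Lemma parabolic_det k g : parabolic k g -> \det g = 1.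
Proof. by case/and3P => /eqP. Qed.

Lemma parabolic1 k : parabolic k 1%:M.
Proof. by rewrite /parabolic adj_1 det1 eqxx corner0_1. Qed.

Lemma parabolicM k g h : parabolic k g -> parabolic k h -> parabolic k (g *m h).
Proof.
case/and3P=> /eqP dg g0 g0' /and3P[/eqP dh h0 h0'].
by rewrite /parabolic adj_mul // det_mulmx dg dh mulr1 eqxx !corner0M.
Qed.

Lemma parabolicV k g : parabolic k g -> parabolic k (\adj g).
Proof.
case/and3P=> /eqP dg g0 g0'.
by rewrite /parabolic adj_adj1 // det_adj1 // eqxx g0 g0'.
Qed.

Lemma parabolic_elem k i j a : i != j :> nat -> ~~ (i < k <= j)%N ->
  parabolic k (elem_mx i j a).
Proof.
move=> ij H; rewrite /parabolic det_elem_mx // adj_elem_mx // eqxx.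
by rewrite !corner0_elem.
Qed.

(* The signed transposition sending e_i to e_j and e_j to - e_i. *)
Definition signed_swap i j : 'M[R]_n :=
  elem_mx i j 1 *m (elem_mx j i (- 1) *m elem_mx i j 1).

Lemma parabolic_swap k i j : i != j -> ~~ (i < k <= j)%N -> ~~ (j < k <= i)%N ->
  parabolic k (signed_swap i j).
Proof.
move=> ij kij kji; rewrite /signed_swap.
by rewrite !(parabolicM, parabolic_elem) // eq_sym.
Qed.

Lemma delta_elem0 (p q i j : 'I_n) a : q != i ->
  delta_mx p q *m elem_mx i j a = delta_mx p q :> 'M_n.
Proof. by move=> qi; rewrite mul_elem_mxr delta_mul0 // scaler0 addr0. Qed.

Lemma delta_elem (p i j : 'I_n) a :
  delta_mx p i *m elem_mx i j a = delta_mx p i + a *: delta_mx p j :> 'M_n.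
Proof. by rewrite mul_elem_mxr mul_delta_mx. Qed.

Lemma elem_delta0 (p q i j : 'I_n) a : j != p ->
  elem_mx i j a *m delta_mx p q = delta_mx p q :> 'M_n.
Proof. by move=> jp; rewrite mul_elem_mxl delta_mul0 // scaler0 addr0. Qed.

Lemma elem_delta (q i j : 'I_n) a :
  elem_mx i j a *m delta_mx j q = delta_mx j q + a *: delta_mx i q :> 'M_n.
Proof. by rewrite mul_elem_mxl mul_delta_mx. Qed.

Lemma signed_swap_row p i j a : i != j -> p != i -> p != j ->
  elem_mx p i a *m signed_swap i j = signed_swap i j *m elem_mx p j a.
Proof.
move=> ij pi pj; have ji : j != i by rewrite eq_sym.
have [ip jp] : i != p /\ j != p by rewrite ![_ == p]eq_sym.
rewrite mul_elem_mxl mul_elem_mxr; congr (_ + _ *: _).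
rewrite /signed_swap -!mulmxA (elem_delta0 _ _ _ jp) (elem_delta0 _ _ _ ip).
rewrite (elem_delta0 _ _ _ jp) !mulmxA delta_elem scale1r mulmxDl delta_elem0 //.
by rewrite delta_elem scaleN1r addrCA subrr addr0 delta_elem0.
Qed.

Lemma signed_swap_col q i j a : i != j -> q != i -> q != j ->
  elem_mx j q a *m signed_swap i j = signed_swap i j *m elem_mx i q (- a).
Proof.
move=> ij qi qj; have ji : j != i by rewrite eq_sym.
rewrite mul_elem_mxl mul_elem_mxr scaleNr -scalerN; congr (_ + _ *: _).
rewrite /signed_swap -!mulmxA (elem_delta0 _ _ _ ji) elem_delta scaleN1r.
rewrite mulmxBr elem_delta0 // elem_delta scale1r opprB addrK.
by rewrite !mulmxA !delta_elem0.
Qed.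
End ElementaryMatrices.

(** * Steinberg relations in the amalgam of parabolics *)

Section GroupCommutators.
Local Open Scope group_scope.
Variable G : groupType.
Implicit Types x y u v c d : G.

Definition lcomm x v := x * v * x^-1 * v^-1.

Lemma lcommE x v c : x * v = c * (v * x) -> lcomm x v = c.
Proof. by rewrite /lcomm => ->; rewrite !mulgA !mulgK. Qed.

Lemma lcommP x v : x * v = lcomm x v * (v * x).
Proof. by rewrite /lcomm !mulgA !mulgVK. Qed.

Lemma lcomm1P x v : lcomm x v = 1 <-> commute x v.
Proof.
split=> [e|e]; first by rewrite /commute [LHS]lcommP e mul1g.
by apply: lcommE; rewrite mul1g.
Qed.

Lemma lcommV x v : (lcomm x v)^-1 = lcomm v x.
Proof. by rewrite /lcomm !invgM !invgK !mulgA. Qed.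

Lemma lcomm_mulr x d v : lcomm x (d * v) = lcomm x d * (d * lcomm x v * d^-1).
Proof. by rewrite /lcomm !invgM !mulgA !mulgVK. Qed.

Lemma lcomm_mull x d v : lcomm (d * x) v = d * lcomm x v * d^-1 * lcomm d v.
Proof. by rewrite /lcomm !invgM !mulgA !mulgVK. Qed.

Lemma lcomm_conj u x v :
  u * lcomm x v * u^-1 = lcomm (u * x * u^-1) (u * v * u^-1).
Proof. by rewrite /lcomm !invgM !invgK !mulgA !mulgVK. Qed.

Lemma commute_conj u v : commute u v -> u * v * u^-1 = v.
Proof. by move=> e; rewrite e mulgK. Qed.

Lemma conj_lcomm u v : u * v * u^-1 = lcomm u v * v.
Proof. by rewrite /lcomm mulgVK. Qed.

Lemma commute_lcomm u x v : commute u x -> commute u v -> commute u (lcomm x v).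
Proof. by move=> ux uv; rewrite /lcomm; do !apply: commuteM => //; apply: commuteV. Qed.

(** Conjugation by x fixes v and turns u into [lcomm x u * u]; expanding the first argument then
    leaves [lcomm (lcomm x u) v] as the only new factor. This is an associativity law for a chain x,
    u, v whose end terms commute. *)
Lemma lcomm_lcomm x u v : commute x v ->
  commute (lcomm x u) (lcomm u v) -> commute (lcomm (lcomm x u) v) (lcomm u v) ->
  lcomm x (lcomm u v) = lcomm (lcomm x u) v.
Proof.
move=> xv cuv duv; rewrite {1}/lcomm lcomm_conj conj_lcomm (commute_conj xv).
by rewrite lcomm_mull (commute_conj cuv) -duv mulgK.
Qed.

Lemma commute_conj_inv s x x' v v' :
  x * s = s * x' -> v * s = s * v' -> commute x' v' -> commute x v.
Proof.
move=> xs vs xv; apply: (@mulIg _ s); rewrite -mulgA vs mulgA xs.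
by rewrite -[RHS]mulgA xs [RHS]mulgA vs -!mulgA xv.
Qed.
End GroupCommutators.

(** * Root elements and the Steinberg relations between them *)

Section SteinbergMap.
Variables (R : comNzRingType) (n m : nat) (Gam : groupType).
(** A compatible family of homomorphisms from P_1, ..., P_m to any group, that is, a homomorphism
    from their amalgam; the values of [gen k] outside P_k are arbitrary. *)
Variable gen : nat -> 'M[R]_n -> Gam.
Implicit Types (i j l p q a b : 'I_n) (k : nat) (s t r : R).
Hypothesis lt2m : (2 < m)%N.
Hypothesis ltmn : (m < n)%N.
Hypothesis genM : forall k g h, (0 < k <= m)%N -> parabolic k g -> parabolic k h ->
  gen k (g *m h) = (gen k g * gen k h)%g.
Hypothesis gen_indep : forall k k' g, (0 < k <= m)%N -> (0 < k' <= m)%N ->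
  parabolic k g -> parabolic k' g -> gen k g = gen k' g.
Local Open Scope group_scope.

Fact n_gt0 : (0 < n)%N. Proof. by lia. Qed.
Fact n_gt1 : (1 < n)%N. Proof. by lia. Qed.
Fact n_gt2 : (2 < n)%N. Proof. by lia. Qed.
Let o := Ordinal n_gt0.
Let one := Ordinal n_gt1.
Let two := Ordinal n_gt2.

(* The only elementary matrices lying in none of the parabolics P_1, ..., P_m
   are the e_{0j} with j >= m; they are reached as commutators. *)
Definition root_elt i j s : Gam :=
  if i == 0 :> nat then
    if (j < m)%N then gen m (elem_mx i j s)
    else lcomm (gen m (elem_mx i one s)) (gen 1 (elem_mx one j 1%R))
  else gen 1 (elem_mx i j s).

Lemma root_gen (k : nat) i j s : (0 < k <= m)%N -> i != j :> nat ->
  (0 < i)%N || (j < m)%N -> ~~ (i < k <= j)%N -> root_elt i j s = gen k (elem_mx i j s).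
Proof.
move=> km ij ok Hk; rewrite /root_elt; case: eqP => i0.
  rewrite i0 /= in ok; rewrite ok; apply: gen_indep => //; first by lia.
    by apply: parabolic_elem => //; lia.
  by apply: parabolic_elem => //; lia.
by apply: gen_indep => //; try lia; apply: parabolic_elem => //; lia.
Qed.

Section CommonParabolic.
Variable k : nat.
Hypothesis km : (0 < k <= m)%N.

(** Relations inside one P_k carry over through the homomorphism [gen k]. The side conditions
    exclude the far roots e_{0j}, j >= m, and place the others in P_k. *)
Lemma rootD_in i j s t : i != j :> nat -> (0 < i)%N || (j < m)%N ->
  ~~ (i < k <= j)%N -> root_elt i j s * root_elt i j t = root_elt i j (s + t).
Proof.
move=> ij ok Hk; rewrite !(@root_gen k) // -genM ?parabolic_elem //.
by rewrite elem_mxD.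
Qed.

Lemma root_commute_in i j p q s t : i != j :> nat -> p != q :> nat ->
  j != p :> nat -> i != q :> nat -> (0 < i)%N || (j < m)%N -> (0 < p)%N || (q < m)%N ->
  ~~ (i < k <= j)%N -> ~~ (p < k <= q)%N -> commute (root_elt i j s) (root_elt p q t).
Proof.
move=> ij pq jp iq ok ok' Hk Hk'; rewrite /commute !(@root_gen k) //.
by rewrite -!genM ?parabolic_elem // elem_mxC.
Qed.

Lemma root_lcomm_in i j l s t : i != j :> nat -> j != l :> nat -> i != l :> nat ->
  (0 < i)%N || (j < m)%N -> (0 < j)%N || (l < m)%N -> (0 < i)%N || (l < m)%N ->
  ~~ (i < k <= j)%N -> ~~ (j < k <= l)%N ->
  lcomm (root_elt i j s) (root_elt j l t) = root_elt i l (s * t)%R.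
Proof.
move=> ij jl il ok ok' ok2 Hk Hk'; have Hk2 : ~~ (i < k <= l)%N by lia.
rewrite !(@root_gen k) //; apply: lcommE.
by rewrite -!genM ?parabolicM ?parabolic_elem // elem_mx_comm.
Qed.
End CommonParabolic.

Lemma rootN_in i j s : i != j :> nat -> (0 < i)%N || (j < m)%N ->
  (root_elt i j s)^-1 = root_elt i j (- s).
Proof.
move=> ij ok; pose k := if (0 < i)%N then 1%N else m.
have km : (0 < k <= m)%N by rewrite /k; case: ifP; lia.
have Hk : ~~ (i < k <= j)%N by rewrite /k; case: ifP => //; lia.
apply: mulg1_eq; rewrite (rootD_in km) // addrN.
have -> : root_elt i j 0 = gen k 1%:M by rewrite (root_gen 0 km) // elem_mx0.
apply: (@mulgI _ (gen k 1%:M)).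
by rewrite -genM ?parabolic1 // mulmx1 mulg1.
Qed.

(* No P_k contains both factors, but the signed swap of a and b lies in P_1 and
   in P_m, and conjugating by it moves both factors into P_a. *)
Lemma root_commute_swap a b l s t : (0 < b)%N -> (b < a)%N -> (a < m)%N ->
  (m <= l)%N -> commute (root_elt o a s) (root_elt b l t).
Proof.
move=> b0 ba am ml; pose w := signed_swap R a b.
have wP k : (k = 1)%N \/ (k = m) -> parabolic k w.
  move=> Hk; apply: parabolic_swap; first by rewrite neq_ltn ba orbT.
    by case: Hk; lia.
  by case: Hk; lia.
have [m1 mm] : (0 < 1 <= m)%N /\ (0 < m <= m)%N by lia.
have ab : a != b :> nat by lia.
have wE : gen 1 w = gen m w by apply: gen_indep => //; apply: wP; [left|right].
apply: (@commute_conj_inv _ (gen 1 w) _ (root_elt o b s) _ (root_elt a l (- t)%R)).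
- rewrite wE !(@root_gen m) /= ?andbF //; try lia.
  rewrite -!genM ?parabolic_elem ?wP //=; try lia; try by right.
  by rewrite signed_swap_row // -val_eqE /=; lia.
- rewrite !(@root_gen 1) //; try lia.
  rewrite -!genM ?parabolic_elem ?wP //=; try lia; try by left.
  by rewrite signed_swap_col // -val_eqE /=; lia.
by apply: (@root_commute_in a); rewrite /=; lia.
Qed.

Lemma root_commute_mid a b l s t : (0 < a < m)%N -> (0 < b < m)%N ->
  a != b :> nat -> (m <= l)%N -> commute (root_elt o a s) (root_elt b l t).
Proof.
move=> am bm ab ml; case: (ltnP b a) => ba.
  by apply: root_commute_swap; lia.
(* For a < b both factors already lie in P_b. *)
by apply: (@root_commute_in b); rewrite /=; lia.
Qed.

(* For m <= l, root_elt o l s unfolds to the case a = 1, t = 1 of z; that z a l s t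
   depends only on l and s * t uses a second index in (0, m), hence 3 <= m. *)
Let z a l s t := lcomm (root_elt o a s) (root_elt a l t).

Lemma lcomm_mid_commute a b l l' s t r : (0 < a < m)%N -> (0 < b < m)%N ->
  a != b :> nat -> (m <= l)%N -> (m <= l')%N ->
  commute (z a l s t) (root_elt b l' r).
Proof.
move=> am bm ab ml ml'; apply/commute_sym/commute_lcomm.
  by apply/commute_sym/root_commute_mid.
by apply: (@root_commute_in 1); lia.
Qed.

(** The chain e_{0b}(s), e_{ba}(t), e_{al}(r) is bracketed in its two ways by [lcomm_lcomm]: the
    inner bracket is e_{bl}(tr) in one and e_{0a}(st) in the other. Its three commutation conditions
    all reduce to middle roots. *)
Lemma lcomm_mid_shift a b l s t r : (0 < a < m)%N -> (0 < b < m)%N -> a != b :> nat ->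
  (m <= l)%N -> z b l s (t * r)%R = z a l (s * t)%R r.
Proof.
move=> am bm ab ml; rewrite /z.
have -> : root_elt b l (t * r)%R = lcomm (root_elt b a t) (root_elt a l r).
  by rewrite (@root_lcomm_in 1) //; lia.
have e : lcomm (root_elt o b s) (root_elt b a t) = root_elt o a (s * t)%R.
  by rewrite (@root_lcomm_in m) //=; lia.
have e' : lcomm (root_elt b a t) (root_elt a l r) = root_elt b l (t * r)%R.
  by rewrite (@root_lcomm_in 1) //; lia.
rewrite lcomm_lcomm ?e ?e' //.
- by apply: root_commute_mid => //; lia.
- by apply: root_commute_mid.
by apply: lcomm_mid_commute.
Qed.

Lemma lcomm_mid_root a l s t : (0 < a < m)%N -> (m <= l)%N -> z a l s t = root_elt o l (s * t)%R.
Proof.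
move=> am ml.
have -> : root_elt o l (s * t)%R = z one l (s * t)%R 1%R.
  rewrite /z (@root_gen m o one) //=; try lia.
  rewrite (@root_gen 1 one) //=; try lia.
  by rewrite /root_elt /= ltnNge ml.
case: (eqVneq (a : nat) 1%N) => [a1|a1].
  have -> : a = one by apply: val_inj.
  (* A shift must change the middle index, so for a = 1 the coefficient is moved by going to index 2
     and back. *)
  have := @lcomm_mid_shift two one l s t 1%R; rewrite mulr1 => -> //=; try lia.
  by have := @lcomm_mid_shift one two l (s * t)%R 1%R 1%R; rewrite !mulr1 => -> //=; lia.
by have := @lcomm_mid_shift one a l s t 1%R; rewrite !mulr1 => -> //=; lia.
Qed.

(** Far roots are expanded through a middle index chosen away from one index of the other factor; 1
    and 2 always leave such a choice. *)
Lemma ex_mid_other (c : nat) : exists2 a : 'I_n, (0 < a < m)%N & a != c :> nat.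
Proof.
case: (eqVneq 1%N c) => [<-|c1]; last by exists one => //=; lia.
by exists two => //=; lia.
Qed.

Lemma root_far_lcommE a l s : (0 < a < m)%N -> (m <= l)%N ->
  root_elt o l s = lcomm (root_elt o a s) (root_elt a l 1%R).
Proof. by move=> am ml; rewrite -[RHS]/(z a l s 1%R) lcomm_mid_root ?mulr1. Qed.

Lemma root_far_commute l p q s t : (m <= l)%N -> p != q :> nat -> p != l :> nat ->
  (0 < q)%N -> commute (root_elt o l s) (root_elt p q t).
Proof.
move=> ml pq pl q0.
have mid_far p' q' r r' : (0 < p' < m)%N -> (m <= q')%N ->
    commute (root_elt o l r) (root_elt p' q' r').
  move=> pm mq; have [a am ap] := ex_mid_other p'.
  by rewrite (root_far_lcommE _ am) //; apply: lcomm_mid_commute.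
have o_near q' r r' : (0 < q' < m)%N -> commute (root_elt o l r) (root_elt o q' r').
  move=> qm; have [a am aq] := ex_mid_other q'.
  rewrite (root_far_lcommE _ am) //; apply/commute_sym/commute_lcomm.
    by apply: (@root_commute_in m); rewrite /=; lia.
  by apply: root_commute_mid; rewrite 1?eq_sym.
have [p0|p_gt0] := posnP p.
  have -> : p = o by apply: val_inj.
  have [qm|mq] := ltnP q m; first by apply: o_near; rewrite q0.
  have [a am _] := ex_mid_other 0.
  rewrite (root_far_lcommE t am mq); apply: commute_lcomm; first exact: o_near.
  exact: mid_far.
have [pm|mp] := ltnP p m; last first.
  have [a am aq] := ex_mid_other q.
  rewrite (root_far_lcommE _ am ml); apply/commute_sym/commute_lcomm.
    by apply: (@root_commute_in m); rewrite /=; lia.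
  by apply: (@root_commute_in 1); lia.
have [qm|mq] := ltnP q m; last by apply: mid_far; rewrite ?p_gt0.
(* With p and q both middle there is no third middle index when m = 3, so the far root is expanded
   through q itself. Conjugation by e_{pq}(t) fixes e_{0q}(s) and multiplies e_{ql}(1) by e_{pl}(t),
   which contributes a trivial commutator and commutes with e_{0l}(s). *)
have qm' : (0 < q < m)%N by rewrite q0.
have d_z : commute (root_elt p l (t * 1)%R) (root_elt o l s).
  by apply/commute_sym/mid_far; rewrite ?p_gt0.
have d_x : commute (root_elt o q s) (root_elt p l (t * 1)%R).
  by apply: root_commute_mid; lia.
have u_x : commute (root_elt p q t) (root_elt o q s).
  by apply: (@root_commute_in m); rewrite /=; lia.
have uv : lcomm (root_elt p q t) (root_elt q l 1%R) = root_elt p l (t * 1)%R.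
  by apply: (@root_lcomm_in 1); lia.
apply/commute_sym; rewrite {1}/commute; apply: (@mulIg _ (root_elt p q t)^-1).
rewrite mulgK [in LHS](root_far_lcommE _ qm' ml) lcomm_conj (commute_conj u_x).
rewrite conj_lcomm uv lcomm_mulr -(root_far_lcommE _ qm' ml).
by rewrite (commute_conj d_z) (lcomm1P _ _).2 // mul1g.
Qed.

(** Additivity is inherited from the first argument of the commutator, because e_{0a} and the far
    roots commute with one another. *)
Lemma root_far_D l s t : (m <= l)%N ->
  root_elt o l s * root_elt o l t = root_elt o l (s + t).
Proof.
move=> ml; have [a am _] := ex_mid_other 0.
have c r r' : commute (root_elt o l r) (root_elt o l r').
  by apply: root_far_commute; rewrite /=; lia.
have c' r r' : commute (root_elt o a r) (root_elt o l r').
  by apply/commute_sym/root_far_commute; rewrite /=; lia.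
rewrite [RHS](root_far_lcommE _ am ml) -(rootD_in (k := m)) /=; try lia.
rewrite lcomm_mull -!(root_far_lcommE _ am ml) (commute_conj (c' _ _)).
exact: c.
Qed.

(** Conjugating e_{0l}(s) = [e_{0a}(s), e_{al}(1)] by e_{lq}(t) fixes the first entry and multiplies
    the second by e_{aq}(-t); the extra factor that comes out is e_{0q}(-st). *)
Lemma root_far_lcomm l q s t : (m <= l)%N -> (0 < q)%N -> l != q :> nat ->
  lcomm (root_elt o l s) (root_elt l q t) = root_elt o q (s * t)%R.
Proof.
move=> ml q0 lq; have [a am aq] := ex_mid_other q.
have u_x : commute (root_elt l q t) (root_elt o a s).
  by apply: (@root_commute_in m); rewrite /=; lia.
have vu : lcomm (root_elt a l 1%R) (root_elt l q t) = root_elt a q t.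
  by rewrite (@root_lcomm_in 1) ?mul1r //; lia.
have xd r : lcomm (root_elt o a s) (root_elt a q r) = root_elt o q (s * r)%R.
  have [qm|mq] := ltnP q m; last exact: lcomm_mid_root.
  by rewrite (@root_lcomm_in m) //=; lia.
have dz r : commute (root_elt a q r) (root_elt o l s).
  by apply/commute_sym/root_far_commute; lia.
have oqN : (root_elt o q (s * - t))^-1 = root_elt o q (s * t).
  have [qm|mq] := ltnP q m; first by rewrite rootN_in //= ?mulrN ?opprK //; lia.
  apply: mulg1_eq; rewrite root_far_D // -mulrDr addNr mulr0.
  by apply: (@mulgI _ (root_elt o q 0)); rewrite root_far_D // addr0 mulg1.
have e : root_elt l q t * root_elt o l s * (root_elt l q t)^-1 =
    root_elt o q (s * - t) * root_elt o l s.
  rewrite (root_far_lcommE _ am ml) lcomm_conj (commute_conj u_x) conj_lcomm.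
  rewrite -[lcomm (root_elt l q t) _]lcommV vu rootN_in; try lia.
  by rewrite lcomm_mulr xd -(root_far_lcommE _ am ml) (commute_conj (dz _)).
have -> : lcomm (root_elt o l s) (root_elt l q t) =
    root_elt o l s * (root_elt l q t * root_elt o l s * (root_elt l q t)^-1)^-1.
  by rewrite /lcomm !invgM invgK !mulgA.
by rewrite e invgM mulVKg oqN.
Qed.

(** Conjugating [e_{0a}(t), e_{al}(1)] by e_{p0}(s) fixes the second entry and multiplies the first
    by e_{pa}(st), whose commutator with e_{al}(1) is e_{pl}(st). *)
Lemma root_far_lcomm_r p l s t : (m <= l)%N -> (0 < p)%N -> p != l :> nat ->
  lcomm (root_elt p o s) (root_elt o l t) = root_elt p l (s * t)%R.
Proof.
move=> ml p0 pl; have [a am ap] := ex_mid_other p.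
have ux : lcomm (root_elt p o s) (root_elt o a t) = root_elt p a (s * t)%R.
  by rewrite (@root_lcomm_in m) //=; lia.
have uv : commute (root_elt p o s) (root_elt a l 1%R).
  by apply: (@root_commute_in 1); rewrite /=; lia.
have dz : commute (root_elt p a (s * t)%R) (root_elt o l t).
  by apply/commute_sym/root_far_commute; lia.
have dv : lcomm (root_elt p a (s * t)%R) (root_elt a l 1%R) = root_elt p l (s * t)%R.
  by rewrite (@root_lcomm_in 1) ?mulr1 //; lia.
rewrite /lcomm [in X in X / _](root_far_lcommE t am ml) lcomm_conj conj_lcomm ux.
rewrite (commute_conj uv) lcomm_mull dv -(root_far_lcommE _ am ml) (commute_conj dz).
have c : commute (root_elt o l t) (root_elt p l (s * t)%R).
  by apply: root_far_commute; lia.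
by rewrite c mulgK.
Qed.

Theorem root_eltD i j s t : i != j -> root_elt i j s * root_elt i j t = root_elt i j (s + t).
Proof.
rewrite -val_eqE /= => ij; have [i0|i_gt0] := posnP i.
  have [jm|mj] := ltnP j m; first by apply: (rootD_in (k := m)); lia.
  by rewrite (_ : i = o) ?root_far_D //; apply: val_inj.
by apply: (rootD_in (k := 1)); lia.
Qed.

Theorem root_elt_commute i j p q s t : i != j -> p != q -> j != p -> i != q ->
  commute (root_elt i j s) (root_elt p q t).
Proof.
rewrite -!val_eqE /= => ij pq jp iq.
(* If neither i nor p is 0, both factors lie in P_1; otherwise, by symmetry, the first one may be
   taken to be e_{0j}. *)
have wlog_o j' p' q' r r' : (0 < j')%N -> p' != q' :> nat -> j' != p' :> nat ->
    (0 < q')%N -> commute (root_elt o j' r) (root_elt p' q' r').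
  move=> j0 pq' jp' q0; have [jm|mj] := ltnP j' m; last first.
    by apply: root_far_commute; rewrite // eq_sym.
  have [p0|p_gt0] := posnP p'.
    have [qm|mq] := ltnP q' m; first by apply: (@root_commute_in m); rewrite /=; lia.
    rewrite (_ : p' = o); last exact: val_inj.
    by apply/commute_sym/root_far_commute; rewrite /=; lia.
  have [qm|mq] := ltnP q' m; first by apply: (@root_commute_in m); rewrite /=; lia.
  have [pm|mp] := ltnP p' m; first by apply: root_commute_mid; lia.
  by apply: (@root_commute_in m); rewrite /=; lia.
have [i0|i_gt0] := posnP i.
  have ei : i = o by apply: val_inj.
  by rewrite ei; apply: wlog_o; lia.
have [p0|p_gt0] := posnP p.
  have ep : p = o by apply: val_inj.
  by rewrite ep; apply/commute_sym/wlog_o; lia.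
by apply: (@root_commute_in 1); lia.
Qed.

Theorem root_elt_lcomm i j l s t : i != j -> j != l -> i != l ->
  lcomm (root_elt i j s) (root_elt j l t) = root_elt i l (s * t)%R.
Proof.
rewrite -!val_eqE /= => ij jl il; have [i0|i_gt0] := posnP i.
  have ei : i = o by apply: val_inj.
  have [jm|mj] := ltnP j m; last by rewrite ei root_far_lcomm //; lia.
  have [lm|ml] := ltnP l m; first by apply: (@root_lcomm_in m); lia.
  by rewrite ei; apply: lcomm_mid_root; lia.
have [j0|j_gt0] := posnP j; last by apply: (@root_lcomm_in 1); lia.
have [lm|ml] := ltnP l m; first by apply: (@root_lcomm_in m); lia.
by rewrite (_ : j = o) ?root_far_lcomm_r //; apply: val_inj.
Qed.
End SteinbergMap.

(** * Surjectivity of the Steinberg map *)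

Section ElementaryWords.
Variable R : comNzRingType.

Definition letter_in (n k : nat) (a : stletter R n) :=
  (st_i a != st_j a) && ~~ (st_i a < k <= st_j a)%N.

Definition map_letter (p q : nat) (f : 'I_p -> 'I_q) (a : stletter R p) :=
  StL (f (st_i a)) (f (st_j a)) (st_l a) (st_inv a).

Lemma letter_mxE n (a : stletter R n) :
  letter_mx a = elem_mx (st_i a) (st_j a) (if st_inv a then - st_l a else st_l a).
Proof. by rewrite /letter_mx; case: ifP. Qed.

Lemma word_mx_cat n (w w' : seq (stletter R n)) :
  word_mx (w ++ w') = word_mx w *m word_mx w'.
Proof. by elim: w => [|a w IH] /=; rewrite ?mul1mx // IH mulmxA. Qed.

Lemma letter_parabolic n k (a : stletter R n) :
  letter_in k a -> parabolic k (letter_mx a).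
Proof. by case/andP=> ij ka; rewrite letter_mxE; apply: parabolic_elem. Qed.

Lemma word_parabolic n k (w : seq (stletter R n)) :
  all (letter_in k) w -> parabolic k (word_mx w).
Proof.
elim: w => [|a w IH] /=; first by rewrite parabolic1.
by case/andP=> /letter_parabolic ka /IH; apply: parabolicM.
Qed.

Section Blocks.
Variables a b : nat.

Lemma elem_mx_lshift (i j : 'I_a) (s : R) :
  elem_mx (lshift b i) (lshift b j) s = block_mx (elem_mx i j s) 0 0 1%:M.
Proof.
rewrite /elem_mx delta_mx_ushift delta_mx_lshift scalar_mx_block.
rewrite -[X in col_mx _ X]row_mx0 -block_mxEv scale_block_mx add_block_mx.
by rewrite !scaler0 !addr0.
Qed.

Lemma elem_mx_rshift (i j : 'I_b) (s : R) :
  elem_mx (rshift a i) (rshift a j) s = block_mx 1%:M 0 0 (elem_mx i j s).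
Proof.
rewrite /elem_mx delta_mx_dshift delta_mx_rshift scalar_mx_block.
rewrite -[X in col_mx X _]row_mx0 -block_mxEv scale_block_mx add_block_mx.
by rewrite !scaler0 !addr0.
Qed.

Lemma elem_mx_rlshift (i : 'I_b) (j : 'I_a) (s : R) :
  elem_mx (rshift a i) (lshift b j) s = block_mx 1%:M 0 (s *: delta_mx i j) 1%:M.
Proof.
rewrite /elem_mx delta_mx_dshift delta_mx_lshift scalar_mx_block.
rewrite -[X in col_mx X _]row_mx0 -block_mxEv scale_block_mx add_block_mx.
by rewrite !scaler0 !addr0 add0r.
Qed.

Lemma word_mx_lshift (w : seq (stletter R a)) :
  word_mx (map (map_letter (lshift b)) w) = block_mx (word_mx w) 0 0 1%:M.
Proof.
elim: w => [|c w IH] /=; first by rewrite -scalar_mx_block.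
rewrite IH !letter_mxE elem_mx_lshift mulmx_block.
by rewrite !(mulmx0, mul0mx, mulmx1, mul1mx, addr0, add0r).
Qed.

Lemma word_mx_rshift (w : seq (stletter R b)) :
  word_mx (map (map_letter (@rshift a b)) w) = block_mx 1%:M 0 0 (word_mx w).
Proof.
elim: w => [|c w IH] /=; first by rewrite -scalar_mx_block.
rewrite IH !letter_mxE elem_mx_rshift mulmx_block.
by rewrite !(mulmx0, mul0mx, mulmx1, mul1mx, addr0, add0r).
Qed.

(** Multiplying lower unipotent block matrices adds their corners, so X can be built up entry by
    entry. *)
Lemma word_lower_unipotent (X : 'M[R]_(b, a)) :
  exists w, all (@letter_in (a + b) a) w /\ word_mx w = block_mx 1%:M 0 X 1%:M.
Proof.
pose P X := exists w, all (@letter_in (a + b) a) w /\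
  word_mx w = block_mx 1%:M 0 X 1%:M.
have P0 : P 0 by exists [::]; rewrite -scalar_mx_block.
have PD Y Z : P Y -> P Z -> P (Y + Z).
  move=> [w [wP wE]] [w' [wP' wE']]; exists (w ++ w'); split.
    by rewrite all_cat wP.
  rewrite word_mx_cat wE wE' mulmx_block.
  by rewrite !(mulmx0, mul0mx, mulmx1, mul1mx, addr0, add0r).
suff: P X by [].
rewrite [X]matrix_sum_delta; apply: (big_ind P) => // i _; apply: (big_ind P) => // j _.
exists [:: xl (rshift a i) (lshift b j) (X i j)]; split => /=.
  by rewrite /letter_in /= -val_eqE /=; have := ltn_ord j; lia.
by rewrite mulmx1 letter_mxE elem_mx_rlshift.
Qed.

(** For g with diagonal blocks A, D and lower corner C, the factorisation is diag(1, D) times the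
    unipotent matrix with corner D^-1 C A^-1 times diag(A, 1). Both A and D have determinant 1, so
    generation by elementary matrices applies to each. *)
Lemma block_parabolic_word (g : 'M[R]_(a + b)) : (0 < a)%N -> (0 < b)%N ->
  SL_elementary R -> \det g = 1 -> ursubmx g = 0 -> \det (ulsubmx g) = 1 ->
  exists w, all (@letter_in (a + b) a) w /\ word_mx w = g.
Proof.
move=> a0 b0 slE; rewrite -[g]submxK block_mxKur block_mxKul.
move: (ulsubmx g) (ursubmx g) (dlsubmx g) (drsubmx g) => A B C D dg B0 dA.
rewrite {B}B0 det_lblock dA mul1r in dg *.
have [w [wv wE]] := slE _ a0 A dA; have [w' [wv' wE']] := slE _ b0 D dg.
have [u [uP uE]] := word_lower_unipotent (\adj D *m C *m \adj A).
exists (map (map_letter (@rshift a b)) w' ++ u ++ map (map_letter (lshift b)) w).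
split.
  rewrite !all_cat uP !all_map /=; apply/andP; split.
    apply: sub_all wv' => c ij; rewrite /letter_in /= (inj_eq (@rshift_inj _ _)) ij /=.
    by lia.
  apply: sub_all wv => c ij; rewrite /letter_in /= (inj_eq (@lshift_inj _ _)) ij /=.
  by have := ltn_ord (st_j c); lia.
rewrite !word_mx_cat word_mx_lshift word_mx_rshift wE wE' uE !mulmx_block.
rewrite !(mulmx0, mul0mx, mulmx1, mul1mx, addr0, add0r) !mulmxA.
by rewrite (mul_mxV dg) mul1mx -mulmxA (mul_adjV dA) mulmx1.
Qed.
End Blocks.

Section LeadingMinor.
Variables n k : nat.
Hypothesis kn : (k <= n)%N.

(** On P_k its determinant is a multiplicative character with unit values, trivial on the elementary
    matrices of P_k: the obstruction to being a word in them. *)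
Definition lead_mx (g : 'M[R]_n) := mxsub (widen_ord kn) (widen_ord kn) g.

Lemma lead_mxM g h : corner0 k g -> lead_mx (g *m h) = lead_mx g *m lead_mx h.
Proof.
move=> /corner0P g0; apply/matrixP => i j; rewrite !mxE.
rewrite (bigID (fun l : 'I_n => (l < k)%N)) /= [X in _ + X]big1 ?addr0.
  by rewrite big_ord_narrow; apply: eq_bigr => l _; rewrite !mxE.
by move=> l; rewrite -leqNgt => kl; rewrite g0 ?mul0r //=.
Qed.

Lemma lead_mx1 : lead_mx 1%:M = 1%:M.
Proof. by apply/matrixP => i j; rewrite !mxE. Qed.

End LeadingMinor.

Lemma parabolic_word n k (kn : (k <= n)%N) (g : 'M[R]_n) : (0 < k)%N -> (k < n)%N ->
  SL_elementary R -> parabolic k g -> \det (lead_mx kn g) = 1 ->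
  exists w, all (@letter_in n k) w /\ word_mx w = g.
Proof.
move=> k0 ltkn slE /and3P[/eqP dg /corner0P g0 _] lg.
have [b nE] : exists b, n = (k + b)%N by exists (n - k)%N; rewrite subnKC.
subst n; apply: block_parabolic_word => //; first by lia.
  apply/matrixP => i j; rewrite !mxE g0 //=; exact: leq_addr.
rewrite -lg; congr (\det _); apply/matrixP => i j; rewrite !mxE.
by congr (g _ _); apply: val_inj.
Qed.

Section DiagonalPairs.
Variable n : nat.
Implicit Types (i j : 'I_n) (u v : R).

(** The entries are written as products so that i = j is allowed and the product and determinant
    formulas need no distinctness. *)
Definition diag_pair i j u v : 'M[R]_n :=
  diag_mx (\row_p ((if p == i then u else 1) * (if p == j then v else 1))).

Lemma diag_pairM i j u v u' v' :
  diag_pair i j u v *m diag_pair i j u' v' = diag_pair i j (u * u') (v * v').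
Proof.
rewrite /diag_pair mul_diag_mx; apply/matrixP => p q; rewrite !mxE.
case: (p == q); rewrite ?mulr0n ?mulr0 ?mulr1n //.
by case: (p == i); case: (p == j); rewrite ?(mul1r, mulr1) // mulrACA.
Qed.

Lemma diag_pair11 i j : diag_pair i j 1 1 = 1%:M.
Proof.
by apply/matrixP => p q; rewrite !mxE; do 2![case: (p == _)]; rewrite ?mulr1.
Qed.

Lemma diag_pair_trans i j l u v : u * v = 1 ->
  diag_pair i j u v *m diag_pair j l u v = diag_pair i l u v.
Proof.
move=> uv; rewrite /diag_pair mul_diag_mx; apply/matrixP => p q; rewrite !mxE.
case: (p == q); rewrite ?mulr0n ?mulr0 ?mulr1n //.
have vu : v * u = 1 by rewrite mulrC.
case: (p == i); case: (p == j); case: (p == l);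
  rewrite ?(mul1r, mulr1, uv, vu, mulrA) //= ?(mul1r, mulr1, uv, vu) //.
Qed.

Lemma corner0_diag_pair k i j u v : corner0 k (diag_pair i j u v).
Proof.
apply/corner0P => p q pk kq; rewrite !mxE; case: (p =P q) => e; last by rewrite mulr0n.
by rewrite -e leqNgt pk in kq.
Qed.

Lemma det_lead_diag_pair k (kn : (k <= n)%N) i j u v :
  \det (lead_mx kn (diag_pair i j u v)) =
  (if (i < k)%N then u else 1) * (if (j < k)%N then v else 1).
Proof.
have prod1 l (x : R) : \prod_(p < k) (if widen_ord kn p == l then x else 1) =
    if (l < k)%N then x else 1.
  case: ifP => lk.
    rewrite (bigD1 (Ordinal lk)) //= ifT ?big1 ?mulr1 //; last exact/eqP/val_inj.
    move=> p; rewrite -!val_eqE /= => /negPf pl; by rewrite pl.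
  apply: big1 => p _; case: eqP => // e.
  by rewrite -e /= ltn_ord in lk.
have -> : lead_mx kn (diag_pair i j u v) = diag_mx (\row_(p < k)
    ((if widen_ord kn p == i then u else 1) * (if widen_ord kn p == j then v else 1))).
  by apply/matrixP => p q; rewrite !mxE.
rewrite det_diag; under eq_bigr => p _ do rewrite mxE.
by rewrite big_split !prod1.
Qed.

Lemma det_diag_pair i j u v : \det (diag_pair i j u v) = u * v.
Proof.
have e (g : 'M[R]_n) : lead_mx (leqnn n) g = g.
  by apply/matrixP => p q; rewrite mxE; congr (g _ _); apply: val_inj.
by rewrite -[diag_pair _ _ _ _]e det_lead_diag_pair !ltn_ord.
Qed.

Lemma parabolic_diag_pair k i j u v : u * v = 1 -> parabolic k (diag_pair i j u v).
Proof.
move=> uv; have d1 : \det (diag_pair i j u v) = 1 by rewrite det_diag_pair.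
rewrite /parabolic d1 eqxx corner0_diag_pair (@adj_unique _ _ _ (diag_pair i j v u)) //.
  exact: corner0_diag_pair.
by rewrite diag_pairM [v * u]mulrC uv diag_pair11.
Qed.
End DiagonalPairs.
End ElementaryWords.

(** * The Steinberg map on words, its image and its kernel *)

Section WordMap.
Variables (R : comNzRingType) (n m : nat) (Gam : groupType).
Variable gen : nat -> 'M[R]_n -> Gam.
Hypothesis lt2m : (2 < m)%N.
Hypothesis ltmn : (m < n)%N.
Hypothesis genM : forall k g h, (0 < k <= m)%N -> parabolic k g -> parabolic k h ->
  gen k (g *m h) = (gen k g * gen k h)%g.
Hypothesis gen_indep : forall k k' g, (0 < k <= m)%N -> (0 < k' <= m)%N ->
  parabolic k g -> parabolic k' g -> gen k g = gen k' g.
Local Open Scope group_scope.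

Let rt := root_elt gen lt2m ltmn.

(** Letters with equal indices may occur in the contexts and free relations of [st_eq]; they are
    sent to 1, so that every word has a value. *)
Definition letter_elt (a : stletter R n) : Gam :=
  if st_i a == st_j a then 1
  else if st_inv a then (rt (st_i a) (st_j a) (st_l a))^-1
  else rt (st_i a) (st_j a) (st_l a).

Definition word_elt (w : seq (stletter R n)) : Gam :=
  foldr (fun a x => letter_elt a * x) 1 w.

Lemma word_elt_cat w w' : word_elt (w ++ w') = word_elt w * word_elt w'.
Proof. by elim: w => [|a w IH] /=; rewrite ?mul1g // IH mulgA. Qed.

Lemma letter_eltV a : letter_elt (stinv a) = (letter_elt a)^-1.
Proof.
rewrite /letter_elt /=; case: (_ == _); rewrite ?invg1 //.
by case: (st_inv a); rewrite /= ?invgK.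
Qed.

Lemma letter_elt_xl i j s : i != j -> letter_elt (xl i j s) = rt i j s.
Proof. by move=> /negPf ij; rewrite /letter_elt /= ij. Qed.

Lemma word_elt_comm a b : word_elt (comm_word a b) = lcomm (letter_elt a) (letter_elt b).
Proof. by rewrite /= !letter_eltV mulg1 /lcomm !mulgA. Qed.

Let rtD i j s t : i != j -> rt i j s * rt i j t = rt i j (s + t).
Proof. exact: root_eltD. Qed.

Let rtV i j s : i != j -> (rt i j s)^-1 = rt i j (- s).
Proof.
move=> ij; apply: mulg1_eq; rewrite rtD // addrN.
by apply: (@mulgI _ (rt i j 0)); rewrite rtD // addr0 mulg1.
Qed.

Lemma word_elt_st_eq w w' : st_eq w w' -> word_elt w = word_elt w'.
Proof.
elim => {w w'} //.
- by move=> w1 w2 w3 _ -> _ ->.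
- by move=> u v w w' _ IH; rewrite !word_elt_cat IH.
- by move=> a; rewrite /= letter_eltV mulg1 mulgV.
- by move=> a; rewrite /= letter_eltV mulg1 mulVg.
- by move=> i j s t ij; rewrite /= !letter_elt_xl // !mulg1 rtD.
- move=> i j p q s t ij pq jp iq; rewrite word_elt_comm !letter_elt_xl //.
  exact/lcomm1P/root_elt_commute.
- move=> i j l s t ij jl il; rewrite word_elt_comm !letter_elt_xl //= mulg1 letter_elt_xl //.
  exact: root_elt_lcomm.
(* The third commutator relation is the inverse of the second with the two factors exchanged. *)
move=> i j p s t ij pi jp; have pj : p != j by rewrite eq_sym.
rewrite word_elt_comm !letter_elt_xl //= letter_elt_xl // mulg1.
by rewrite -lcommV [lcomm _ _]root_elt_lcomm // -/rt rtV.
Qed.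

Lemma gen1 k : (0 < k <= m)%N -> gen k 1%:M = 1.
Proof.
move=> km; apply: (@mulgI _ (gen k 1%:M)).
by rewrite -genM ?parabolic1 // mulmx1 mulg1.
Qed.

Lemma letter_elt_in k a : (0 < k <= m)%N -> letter_in k a ->
  letter_elt a = gen k (letter_mx a).
Proof.
move=> km /andP[ij ka]; rewrite /letter_elt (negPf ij) letter_mxE.
have -> : (if st_inv a then (rt (st_i a) (st_j a) (st_l a))^-1
  else rt (st_i a) (st_j a) (st_l a)) =
  rt (st_i a) (st_j a) (if st_inv a then - st_l a else st_l a)%R.
  by case: ifP; rewrite ?rtV.
by apply: root_gen => //; lia.
Qed.

(** Inside one P_k the map is a homomorphism of matrix groups, so the value of a word depends only
    on its matrix; this is what trivialises words coming from S_3. *)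
Lemma word_elt_in k w : (0 < k <= m)%N -> all (letter_in k) w ->
  word_elt w = gen k (word_mx w).
Proof.
move=> km; elim: w => [|a w IH] /=; first by rewrite gen1.
case/andP=> ka kw; rewrite IH // (letter_elt_in km ka) genM //.
  exact: letter_parabolic.
exact: word_parabolic.
Qed.

Lemma letter_in_valid k w : all (@letter_in R n k) w -> valid_word w.
Proof. by apply: sub_all => a /andP[]. Qed.

Hypothesis slE : SL_elementary R.

Lemma gen_lead1 k (kn : (k <= n)%N) g : (0 < k <= m)%N -> parabolic k g ->
  \det (lead_mx kn g) = 1%R -> exists2 w, valid_word w & gen k g = word_elt w.
Proof.
move=> km kg lg; have [||w [wP wE]] := parabolic_word _ _ slE kg lg; try lia.
by exists w; [apply: letter_in_valid wP|rewrite (word_elt_in km wP) wE].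
Qed.

(* Up to elementary matrices of P_k only g = diag(u, 1, ..., 1, u^-1) remains;
   it is the product of diag(u, u^-1, 1, ..., 1), elementary inside P_m, and
   diag(1, u, 1, ..., 1, u^-1), elementary inside P_1. *)
Lemma gen_word k g : (0 < k <= m)%N -> parabolic k g ->
  exists2 w, valid_word w & gen k g = word_elt w.
Proof.
move=> km kg; have kn : (k <= n)%N by lia.
have lt0n' : (0 < n)%N by lia.
have lt1n' : (1 < n)%N by lia.
have ltn1n : (n.-1 < n)%N by lia.
pose o := Ordinal lt0n'; pose one := Ordinal lt1n'; pose last := Ordinal ltn1n.
pose u := \det (lead_mx kn g); pose u' := \det (lead_mx kn (\adj g)).
have uu' : (u * u' = 1)%R.
  rewrite /u /u' -det_mulmx -lead_mxM; last by case/and3P: kg.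
  by rewrite (mul_mxV (parabolic_det kg)) lead_mx1 det1.
have u'u : (u' * u = 1)%R by rewrite mulrC.
have [m1 mm] : (0 < 1 <= m)%N /\ (0 < m <= m)%N by lia.
have [w wv wE] : exists2 w, valid_word w & gen k (g *m diag_pair o last u' u) = word_elt w.
  apply: (gen_lead1 (kn := kn)) => //; first by rewrite parabolicM ?parabolic_diag_pair.
  rewrite lead_mxM; last by case/and3P: kg.
  rewrite det_mulmx det_lead_diag_pair /= ifT ?ifF ?mulr1 //; lia.
have mn : (m <= n)%N by lia.
have [w1 wv1 wE1] : exists2 w, valid_word w & gen m (diag_pair o one u u') = word_elt w.
  apply: (gen_lead1 (kn := mn)) => //; first exact: parabolic_diag_pair.
  by rewrite det_lead_diag_pair /= !ifT //; lia.
have [w2 wv2 wE2] : exists2 w, valid_word w & gen 1 (diag_pair one last u u') = word_elt w.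
  apply: (gen_lead1 (kn := lt0n')) => //; first exact: parabolic_diag_pair.
  by rewrite det_lead_diag_pair /= !ifF ?mulr1 //; lia.
exists (w ++ w1 ++ w2); first by rewrite /valid_word !all_cat; apply/and3P.
rewrite !word_elt_cat -wE -wE1 -wE2.
(* Diagonal matrices lie in every parabolic, so the factors obtained in P_m and P_1 can be
   multiplied in P_k. *)
rewrite (gen_indep mm km) ?parabolic_diag_pair // (gen_indep m1 km) ?parabolic_diag_pair //.
rewrite -!genM ?parabolicM ?parabolic_diag_pair // diag_pair_trans // -mulmxA.
by rewrite diag_pairM u'u uu' diag_pair11 mulmx1.
Qed.

Variable pr : Gam -> 'M[R]_n.
Hypothesis prM : forall x y, pr (x * y) = pr x *m pr y.
Hypothesis pr_gen : forall k g, (0 < k <= m)%N -> parabolic k g -> pr (gen k g) = g.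

Lemma pr1 : pr 1 = 1%:M.
Proof. by rewrite -(@gen1 1) ?pr_gen ?parabolic1 //; lia. Qed.

Lemma pr_root i j s : i != j -> pr (rt i j s) = elem_mx i j s.
Proof.
move=> ij; rewrite /rt /root_elt; case: eqP => i0; last first.
  by rewrite pr_gen ?parabolic_elem //; lia.
case: ifP => jm; first by rewrite pr_gen ?parabolic_elem //; lia.
set x := gen m _; set v := gen 1 _.
have prx : pr x = elem_mx i (Ordinal (n_gt1 lt2m ltmn)) s.
  by rewrite pr_gen ?parabolic_elem //=; lia.
have prv : pr v = elem_mx (Ordinal (n_gt1 lt2m ltmn)) j 1%R.
  by rewrite pr_gen ?parabolic_elem //=; lia.
(* The commutator c is pinned down by x v = c (v x): the matrix of v x is invertible, and cancelling
   it on the right leaves [pr c]. *)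
move: (lcommP x v); move: (lcomm x v) => c /(congr1 pr).
rewrite !prM prx prv elem_mx_comm ?mulr1 //; try by rewrite -val_eqE /=; lia.
move=> /(congr1 (fun A => A *m (elem_mx i (Ordinal (n_gt1 lt2m ltmn)) (- s)
  *m elem_mx (Ordinal (n_gt1 lt2m ltmn)) j (- 1)))%R).
have K : elem_mx (Ordinal (n_gt1 lt2m ltmn)) j 1 *m elem_mx i (Ordinal (n_gt1 lt2m ltmn)) s
  *m (elem_mx i (Ordinal (n_gt1 lt2m ltmn)) (- s)
     *m elem_mx (Ordinal (n_gt1 lt2m ltmn)) j (- 1)) = 1%:M.
  rewrite -mulmxA [X in _ *m X]mulmxA elem_mxD -?val_eqE /=; last by lia.
  rewrite addrN elem_mx0 mul1mx elem_mxD -?val_eqE /=; last by lia.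
  by rewrite addrN elem_mx0.
by rewrite -!mulmxA !(mulmxA (elem_mx _ j 1)) K !mulmx1 => ->.
Qed.

Lemma pr_word w : valid_word w -> pr (word_elt w) = word_mx w.
Proof.
elim: w => [|a w IH] /=; first by rewrite pr1.
case/andP=> ij wv; rewrite prM IH // letter_mxE /letter_elt (negPf ij).
by case: ifP; rewrite ?rtV // pr_root.
Qed.

Hypothesis k2 : K2_3_surj R n.

Lemma pr_word_inj w : valid_word w -> pr (word_elt w) = 1%:M -> word_elt w = 1.
Proof.
move=> wv; rewrite pr_word // => w1.
have n3 : (3 <= n)%N by lia.
have [w' [w'v [_ e]]] := k2 n3 wv w1.
have m3 : (0 < 3 <= m)%N by lia.
have in3 : all (letter_in 3) (map (embed_letter n3) w').
  rewrite all_map; apply: sub_all w'v => a ij; rewrite /letter_in /= -val_eqE /= ij.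
  by have := ltn_ord (st_j a); lia.
rewrite (word_elt_st_eq e) (word_elt_in m3 in3).
(* The matrix of a valid word is the projection of its value, hence invariant under [st_eq]; so the
   embedded word has the matrix of w. *)
suff -> : word_mx (map (embed_letter n3) w') = 1%:M by exact: gen1.
by rewrite -pr_word ?(letter_in_valid in3) // -(word_elt_st_eq e) pr_word.
Qed.
End WordMap.

(** * Flags of free summands *)

Section CompleteRow.
Variables (R : comNzRingType) (k : nat).
Variables (A : 'M[R]_(k, k + 1)) (D : 'M[R]_(k + 1, k)).

(** The signed maximal minors of A. A cofactor along the last row ignores that row, which is
    therefore filled with 0. *)
Let C (j : 'I_(k + 1)) := cofactor (col_mx A 0) (rshift k 0) j.
Let K (i : 'I_(k + 1)) := cofactor (row_mx D 0) i (rshift k 0).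

Lemma det_col_last r : \det (col_mx A r) = \sum_j r 0 j * C j.
Proof.
rewrite (expand_det_row _ (rshift k 0)); apply: eq_bigr => j _.
rewrite col_mxEd; congr (_ * _); rewrite /C /cofactor; congr (_ * \det _).
apply/matrixP => p q; rewrite !mxE; case: split_ordP => i e //; exfalso.
by have := neq_lift (rshift k (0 : 'I_1)) p; rewrite e [i]ord1 eqxx.
Qed.

Lemma det_row_last s : \det (row_mx D s) = \sum_j s j 0 * K j.
Proof.
rewrite (expand_det_col _ (rshift k 0)); apply: eq_bigr => j _.
rewrite row_mxEr; congr (_ * _); rewrite /K /cofactor; congr (_ * \det _).
apply/matrixP => p q; rewrite !mxE; case: split_ordP => i e //; exfalso.
by have := neq_lift (rshift k (0 : 'I_1)) q; rewrite e [i]ord1 eqxx.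
Qed.

Lemma det_block1 (u : 'M[R]_(k, 1)) v (w : 'M[R]_1) :
  \det (block_mx 1%:M u v w) = \det (w - v *m u).
Proof.
have -> : block_mx 1%:M u v w =
    block_mx 1%:M 0 v 1%:M *m block_mx 1%:M u 0 (w - v *m u).
  by rewrite mulmx_block !(mulmx0, mul0mx, mulmx1, mul1mx, addr0, add0r) addrC subrK.
by rewrite det_mulmx det_lblock det_ublock !det1 !mul1r.
Qed.

(* With e the idempotent 1 - D A, the product of the two bordered
   determinants at (r, s) is r e s; summing over r = s = e_j gives tr e = 1. *)
Lemma complete_row : A *m D = 1%:M -> exists r, \det (col_mx A r) = 1.
Proof.
move=> AD; exists (\row_j K j); rewrite det_col_last.
have CK j : C j * K j = (1%:M - D *m A) j j.
  have <- : \det (col_mx A (delta_mx 0 j)) = C j.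
    rewrite det_col_last (bigD1 j) //= big1 ?addr0 => [|i ij]; last first.
      by rewrite mxE (negPf ij) ?andbF mul0r.
    by rewrite mxE !eqxx mul1r.
  have <- : \det (row_mx D (delta_mx j 0)) = K j.
    rewrite det_row_last (bigD1 j) //= big1 ?addr0 => [|i ij]; last first.
      by rewrite mxE (negPf ij) ?andbF mul0r.
    by rewrite mxE !eqxx mul1r.
  rewrite -det_mulmx mul_col_row AD det_block1 det_mx11.
  rewrite !mulmxA -(mulmxA _ D A) -mulmxBl -[X in X - _]mulmx1 -mulmxBr.
  by rewrite -colE -rowE !mxE.
under eq_bigr => j _ do rewrite mxE mulrC CK.
rewrite -[LHS]/(\tr (1%:M - D *m A)) linearB /= mxtrace_mulC AD !mxtrace1.
by rewrite natrD addrAC subrr add0r.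
Qed.
End CompleteRow.

(** * Free direct summands in matrix form *)

Section Frames.
Variables (R : comNzRingType) (n : nat).
Implicit Types V W : subset_of R n.

(** A free summand of rank k with explicit data: the rows of B are a basis, and x |-> x C B is a
    projection onto V. *)
Definition framed k V := exists (B : 'M[R]_(k, n)) (C : 'M[R]_(n, k)),
  B *m C = 1%:M /\ forall x, V x <-> exists c, x = c *m B.

Lemma lincomb_mx k (c : 'I_k -> R) (b : 'I_k -> 'rV[R]_n) :
  lincomb c b = (\row_i c i) *m (\matrix_i b i).
Proof. by rewrite mulmx_sum_row; apply: eq_bigr => i _; rewrite mxE rowK. Qed.

Lemma framed_proj k V (B : 'M[R]_(k, n)) (C : 'M[R]_(n, k)) :
  B *m C = 1%:M -> (forall x, V x <-> exists c, x = c *m B) ->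
  forall x, V x -> x *m C *m B = x.
Proof. by move=> BC VB x /VB[c ->]; rewrite -(mulmxA c) BC mulmx1. Qed.

Lemma framed_submodule k V : framed k V -> is_submodule V.
Proof.
case=> B [C [BC VB]]; split; first by apply/VB; exists 0; rewrite mul0mx.
split=> [x y /VB[c ->] /VB[d ->]|a x /VB[c ->]]; apply/VB.
  by exists (c + d); rewrite mulmxDl.
by exists (a *: c); rewrite scalemxAl.
Qed.

Lemma framed_summand k V : framed k V -> direct_summand V.
Proof.
move=> fV; split; first exact: framed_submodule fV.
case: fV => B [C [BC VB]]; exists (fun x => x *m C = 0).
split; first split; first by rewrite mul0mx.
- split=> [x y xC yC|a x xC]; first by rewrite mulmxDl xC yC addr0.
  by rewrite -scalemxAl xC scaler0.
split=> [x Vx xC|x]; first by rewrite -(framed_proj BC VB Vx) xC mul0mx.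
exists (x *m C *m B), (x - x *m C *m B); split; first by apply/VB; exists (x *m C).
by split; [rewrite mulmxBl -(mulmxA _ B) BC mulmx1 subrr|rewrite addrC subrK].
Qed.

Lemma framed_basis k V : framed k V ->
  exists b : 'I_k -> 'rV[R]_n, is_basis_of V b.
Proof.
case=> B [C [BC VB]]; exists (fun i => row i B).
have mxB : \matrix_i row i B = B by apply/row_matrixP => i; rewrite rowK.
split; first by move=> i; apply/VB; exists (delta_mx 0 i); rewrite rowE.
split=> [x /VB[c ->]|c].
  exists (fun i => c 0 i); rewrite lincomb_mx mxB; congr (_ *m _).
  by apply/rowP => i; rewrite mxE.
rewrite lincomb_mx mxB => /(congr1 (mulmx^~ C)); rewrite -mulmxA BC mulmx1 mul0mx.
by move=> /rowP c0 i; have := c0 i; rewrite !mxE.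
Qed.

(** Row j of C holds the coordinates of the V-component of the j-th standard vector, for some
    complement W. Then x C B = x on V, and freeness of b turns B C B = B into B C = 1. *)
Lemma summand_framed k V (b : 'I_k -> 'rV[R]_n) :
  direct_summand V -> is_basis_of V b -> framed k V.
Proof.
move=> [[V0 [VD VZ]] [W [[W0 [WD WZ]] [VW sVW]]]] [Vb [genb freeb]].
pose B := \matrix_i b i.
have VB x : V x <-> exists c : 'rV_k, x = c *m B.
  split=> [/genb[c ->]|[c ->]]; first by exists (\row_i c i); rewrite lincomb_mx.
  rewrite mulmx_sum_row; apply: (big_ind V) => // i _; apply: VZ.
  by rewrite rowK.
have /fin_all_exists[c cP] (j : 'I_n) : exists c : 'rV_k, W (delta_mx 0 j - c *m B).
  have [y [z [/VB[c ->] [Wz e]]]] := sVW (delta_mx 0 j).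
  by exists c; rewrite e addrAC subrr add0r.
pose C := \matrix_j c j; exists B, C.
have proj x : V x -> x = x *m C *m B.
  move=> Vx; apply/eqP; rewrite -subr_eq0; apply/eqP; apply: VW.
    by apply/VB; case/VB: Vx => d ->; exists (d - d *m B *m C); rewrite mulmxBl.
  rewrite -mulmxA -{1}[x]mulmx1 -mulmxBr mulmx_sum_row.
  apply: (big_ind W) => // j _; apply: WZ.
  by have := cP j; rewrite linearB /= row1 row_mul rowK.
split=> //; apply/eqP; rewrite -subr_eq0; apply/eqP/row_matrixP => i.
apply/rowP => j; rewrite !mxE.
have := freeb (fun j => (B *m C - 1%:M) i j); rewrite lincomb_mx -/B.
have -> : \row_j (B *m C - 1%:M) i j = row i (B *m C - 1%:M).
  by apply/rowP => j'; rewrite !mxE.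
rewrite -row_mul mulmxBl mul1mx linearB /= !row_mul -proj ?subrr; last by rewrite rowK.
by move=> /(_ erefl j) /=; rewrite !mxE.
Qed.

(** The coordinate matrix B C' of V in V' has the right inverse B' C, which over a nonzero
    commutative ring bounds its number of rows. *)
Lemma framed_sub k k' V V' : framed k V -> framed k' V' ->
  (forall x, V x -> V' x) -> (k <= k')%N.
Proof.
case=> B [C [BC VB]] [B' [C' [BC' VB']]] sVV'.
have BB' : B *m C' *m B' = B.
  apply/row_matrixP => i; rewrite !row_mul (framed_proj BC' VB') //.
  by apply/sVV'/VB; exists (delta_mx 0 i); rewrite rowE.
by apply: (@mulmx1_min _ _ _ (B *m C') (B' *m C)); rewrite mulmxA BB'.
Qed.

Lemma framed_size k V : framed k V -> (k <= n)%N.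
Proof. by case=> B [C [BC _]]; apply: mulmx1_min BC. Qed.

(** If the ranks agreed, B C' would be square with a one-sided inverse, hence invertible, and V
    would be all of V'. *)
Lemma framed_proper k k' V V' : framed k V -> framed k' V' ->
  (forall x, V x -> V' x) -> (exists x, V' x /\ ~ V x) -> (k < k')%N.
Proof.
move=> fV fV' sVV' [x [V'x nVx]].
rewrite ltn_neqAle (framed_sub fV fV' sVV') andbT; apply/eqP => kk'; subst k'.
case: fV nVx => B [C [BC VB]]; case: fV' V'x => B' [C' [BC' VB']] V'x; apply.
have BB' : B *m C' *m B' = B.
  apply/row_matrixP => i; rewrite !row_mul (framed_proj BC' VB') //.
  by apply/sVV'/VB; exists (delta_mx 0 i); rewrite rowE.
have AD : (B *m C') *m (B' *m C) = 1%:M by rewrite mulmxA BB'.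
have B'E : B' = B' *m C *m B by rewrite -BB' [RHS]mulmxA (mulmx1C AD) mul1mx.
by case/VB': V'x => c ->; apply/VB; exists (c *m (B' *m C)); rewrite {1}B'E !mulmxA.
Qed.

Lemma framed_unique k k' V : framed k V -> framed k' V -> k = k'.
Proof.
by move=> f f'; apply/eqP; rewrite eqn_leq (framed_sub f f') ?(framed_sub f' f).
Qed.

(** V splits off V' with a stably free complement of rank one. Completing the coordinate matrix of V
    in V' by one row to determinant 1 shows that complement to be free, and the new row gives r. *)
Lemma framed_step k V V' : framed k V -> framed k.+1 V' ->
  (forall x, V x -> V' x) ->
  exists r, forall x, V' x <-> exists t, V (x - t *: r).
Proof.
move=> fV fV' sVV'; have [V'0 [V'D V'Z]] := framed_submodule fV'.
case: fV => B [C [BC VB]]; move: fV'; rewrite -addn1 => -[B' [C' [BC' VB']]].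
have BB' : B *m C' *m B' = B.
  apply/row_matrixP => i; rewrite !row_mul (framed_proj BC' VB') //.
  by apply/sVV'/VB; exists (delta_mx 0 i); rewrite rowE.
have [|r dr] := @complete_row _ _ (B *m C') (B' *m C); first by rewrite mulmxA BB'.
exists (r *m B') => x; split=> [/VB'[c ->]|[t]].
  pose d := c *m \adj (col_mx (B *m C') r).
  have -> : c = d *m col_mx (B *m C') r by rewrite /d -mulmxA (mul_adjV dr) mulmx1.
  rewrite -[d]hsubmxK mul_row_col; exists (rsubmx d 0 0); apply/VB.
  exists (lsubmx d); rewrite mulmxDl -!mulmxA (mulmxA _ C') BB' [rsubmx d]mx11_scalar.
  by rewrite mul_scalar_mx !mxE addrK.
move=> /sVV' Vx; rewrite -[x](subrK (t *: (r *m B'))); apply: V'D => //; apply: V'Z.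
by apply/VB'; exists r.
Qed.
End Frames.

(** * Simplices as translates of the standard flag *)

Section CoordinateSubmodules.
Variables (R : comNzRingType) (n : nat).
Implicit Types (g h : 'M[R]_n) (V : subset_of R n).

(* The translate by g of the span of the first k basis vectors, for g of
   determinant 1 (whose inverse is then its adjugate). *)
Definition coordsub k g : subset_of R n :=
  fun x => forall j : 'I_n, (k <= j)%N -> (x *m \adj g) 0 j = 0.

(** Together with [coord_eq_parabolic], this identifies the translates of rank k with the cosets P_k
    g in SL_n. *)
Lemma coord_parabolic k g h : parabolic k h -> \det g = 1 ->
  coordsub k (h *m g) = coordsub k g.
Proof.
move=> kh dg; have dh := parabolic_det kh; case/and3P: kh => _ /corner0P h0 /corner0P h0'.
apply/funext => x; apply/propext; rewrite /coordsub adj_mul // mulmxA.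
have low (y : 'rV[R]_n) h' : (forall i j : 'I_n, (i < k)%N -> (k <= j)%N -> h' i j = 0) ->
    (forall j : 'I_n, (k <= j)%N -> y 0 j = 0) ->
    forall j : 'I_n, (k <= j)%N -> (y *m h') 0 j = 0.
  move=> h'0 y0 j kj; rewrite mxE big1 // => l _.
  by case: (ltnP l k) => lk; [rewrite h'0 ?mulr0|rewrite y0 ?mul0r].
split; last exact: low.
by move=> /(low _ _ h0); rewrite -(mulmxA _ _ h) mul_adjV // mulmx1.
Qed.

Lemma coord_framed k g : (k <= n)%N -> \det g = 1 -> framed k (coordsub k g).
Proof.
move=> kn dg; have wid_inj : injective (widen_ord kn).
  by move=> i j /(congr1 val) /= e; apply: val_inj.
exists (rowsub (widen_ord kn) g), (colsub (widen_ord kn) (\adj g)).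
split=> [|x].
  rewrite -mxsub_mul mul_mxV //; apply/matrixP => i j.
  by rewrite !mxE (inj_eq wid_inj).
rewrite /coordsub; split=> [x0|[c ->] j kj].
  exists (colsub (widen_ord kn) (x *m \adj g)).
  rewrite -[LHS]mulmx1 -(mul_adjV dg) mulmxA; move: (x *m \adj g) x0 => y y0.
  apply/rowP => q; rewrite !mxE (bigID (fun l : 'I_n => (l < k)%N)) /= [X in _ + X]big1.
    by rewrite addr0 big_ord_narrow; apply: eq_bigr => l _; rewrite !mxE.
  by move=> l; rewrite -leqNgt => kl; rewrite y0 ?mul0r.
rewrite -mulmxA mul_rowsub_mx mul_mxV // mxE big1 // => i _; rewrite !mxE.
case: eqP => [e|]; last by rewrite mulr0.
by rewrite -e /= leqNgt ltn_ord in kj.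
Qed.

Lemma coord_row k g (i : 'I_n) : (i < k)%N -> \det g = 1 -> coordsub k g (row i g).
Proof.
move=> ik dg j kj; rewrite -row_mul mul_mxV // !mxE; case: eqP => // e.
by rewrite e ltnNge kj in ik.
Qed.

Lemma coord_eq_rank k k' g g' : (k <= n)%N -> (k' <= n)%N -> \det g = 1 ->
  \det g' = 1 -> coordsub k g = coordsub k' g' -> k = k'.
Proof.
move=> kn kn' dg dg' e; apply: framed_unique (coord_framed kn dg) _.
by rewrite e; apply: coord_framed.
Qed.

Lemma coord_eq_parabolic k g g' : \det g = 1 -> \det g' = 1 ->
  coordsub k g = coordsub k g' -> parabolic k (g *m \adj g').
Proof.
have corner h h' : \det h = 1 -> coordsub k h = coordsub k h' -> corner0 k (h *m \adj h').
  move=> dh e; apply/corner0P => i j ik kj.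
  have := coord_row ik dh; rewrite e => /(_ j kj).
  by rewrite -row_mul mxE.
move=> dg dg' e; rewrite /parabolic det_mulmx dg det_adj1 // mulr1 eqxx /=.
by rewrite corner // adj_mul ?det_adj1 // adj_adj1 // corner.
Qed.

Lemma coord_mono k k' g x : (k <= k')%N -> coordsub k g x -> coordsub k' g x.
Proof. by move=> kk' x0 j kj; apply: x0; apply: leq_trans kj. Qed.

Lemma coord_strict k k' g : \det g = 1 -> (k < k' <= n)%N ->
  exists x, coordsub k' g x /\ ~ coordsub k g x.
Proof.
move=> dg /andP[kk' kn']; have kn := leq_trans kk' kn'.
exists (row (Ordinal kn) g); split; first exact: coord_row.
move=> /(_ (Ordinal kn) (leqnn k)); rewrite -row_mul mul_mxV // !mxE eqxx.
by apply/eqP; rewrite oner_eq0.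
Qed.

Lemma coord_nonzero k g : \det g = 1 -> (0 < k <= n)%N -> nonzero_sub (coordsub k g).
Proof.
move=> dg kn; have [x [Vx V0x]] := coord_strict dg kn.
by exists x; split=> // x0; apply: V0x => j _; rewrite x0 mul0mx mxE.
Qed.

Lemma coord_proper k g : \det g = 1 -> (k < n)%N -> Defs.proper_sub (coordsub k g).
Proof.
move=> dg kn; have kn' : (k < n <= n)%N by rewrite kn leqnn.
by have [x [_ nVx]] := coord_strict dg kn'; exists x.
Qed.

Lemma coord_summand k g : (k <= n)%N -> \det g = 1 -> direct_summand (coordsub k g).
Proof. by move=> kn dg; apply: framed_summand (coord_framed kn dg). Qed.

Lemma coord_free k g : (k <= n)%N -> \det g = 1 -> is_free (coordsub k g).
Proof.
move=> kn dg; have f := coord_framed kn dg; split; first exact: framed_submodule f.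
by exists k; apply: framed_basis f.
Qed.

Lemma coord_quotient_free k g : (k <= n)%N -> \det g = 1 -> quotient_free (coordsub k g).
Proof.
move=> kn dg; pose up (i : 'I_(n - k)) := cast_ord (subnKC kn) (rshift k i).
have up_inj : injective up by move=> i j /cast_ord_inj /rshift_inj.
pose w i := row (up i) g; exists (n - k)%N, w.
have coef (c : 'I_(n - k) -> R) i : (lincomb c w *m \adj g) 0 (up i) = c i.
  rewrite mulmx_suml summxE (bigD1 i) //= big1 ?addr0 => [|j ji].
    by rewrite -scalemxAl -row_mul mul_mxV // !mxE eqxx mulr1.
  by rewrite -scalemxAl -row_mul mul_mxV // !mxE (inj_eq up_inj) (negPf ji) mulr0.
split=> [x|c Vc i]; last by rewrite -coef Vc //= leq_addr.
pose c i := (x *m \adj g) 0 (up i); exists c, (x - lincomb c w).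
split; last by rewrite addrC subrK.
move=> j kj; have lt_jk : (j - k < n - k)%N by have := ltn_ord j; lia.
have -> : j = up (Ordinal lt_jk) by apply: val_inj; rewrite /= subnKC.
have := coef c (Ordinal lt_jk); rewrite mulmxBl => coef_j.
by rewrite mxE [X in _ + X]mxE coef_j subrr.
Qed.

Lemma coord_simplex m g ks : (m < n)%N -> \det g = 1 ->
  all (fun k => 0 < k <= m)%N ks -> tits_simplex m [seq coordsub k g | k <- ks].
Proof.
move=> mn dg ksP; have inP V : in_list V [seq coordsub k g | k <- ks] ->
    exists2 k, (0 < k <= m)%N & V = coordsub k g.
  elim: ks ksP => //= k ks IH /andP[km ksP] [->|]; first by exists k.
  exact: IH.
split=> [V /inP[k /andP[k0 km] ->]|].
  have kn : (k <= n)%N by lia.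
  split; last by have [b bP] := framed_basis (coord_framed kn dg); exists k, b.
  split; [exact: coord_summand|split; [|split; [|split]]].
  - by apply: coord_nonzero; rewrite // k0.
  - by apply: coord_proper => //; lia.
  - exact: coord_free.
  exact: coord_quotient_free.
(* Flags are indexed from 0, so member i has rank i + 1. *)
exists (fun i : 'I_n.-1 => coordsub i.+1 g); split; last first.
  move=> V /inP[k /andP[k0 km] ->].
  have lt_kn : (k.-1 < n.-1)%N by lia.
  by exists (Ordinal lt_kn); rewrite /= prednK.
have lt_in (i : 'I_n.-1) : (i.+1 < n)%N by have := ltn_ord i; lia.
split.
  by move=> i; split; [apply: coord_summand|apply: coord_free] => //;
    exact: ltnW (lt_in i).
split; last first.
  split=> i; last by apply: coord_proper => //; apply: lt_in.
  by apply: coord_nonzero => //=; apply: ltnW (lt_in i).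
move=> i j ij; split=> [x|]; first by apply: coord_mono; rewrite ltnS ltnW.
by apply: coord_strict => //; rewrite ltnS ij ltnW ?lt_in.
Qed.

(** Each strict inclusion raises the rank, so counting up from V_0 gives rank at least k and
    counting down from V_n gives rank at most k. *)
Lemma chain_framed (V : nat -> subset_of R n) :
  (forall k, (k <= n)%N -> exists d, framed d (V k)) ->
  (forall k x, (k < n)%N -> V k x -> V k.+1 x) ->
  (forall k, (k < n)%N -> exists x, V k.+1 x /\ ~ V k x) ->
  forall k, (k <= n)%N -> framed k (V k).
Proof.
move=> fV sV pV.
have lo k d : (k <= n)%N -> framed d (V k) -> (k <= d)%N.
  elim: k d => // k IH d kn fd; have [d' fd'] := fV k (ltnW kn).
  apply: leq_ltn_trans (IH _ (ltnW kn) fd') _.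
  by apply: framed_proper fd' fd (fun x => @sV k x kn) (pV k kn).
have hi j d : (j <= n)%N -> framed d (V (n - j)%N) -> (d <= n - j)%N.
  elim: j d => [|j IH] d jn fd; first by rewrite subn0 (framed_size fd).
  have [d' fd'] : exists d', framed d' (V (n - j)%N) by apply: fV; lia.
  have e : (n - j = (n - j.+1).+1)%N by lia.
  have lt : (n - j.+1 < n)%N by lia.
  have := IH _ (ltnW jn) fd'; rewrite e in fd' *.
  have := framed_proper fd fd' (fun x => @sV _ x lt) (pV _ lt); lia.
move=> k kn; have [d fd] := fV k kn; have := lo k d kn fd.
have kE : k = (n - (n - k))%N by lia.
have := hi (n - k)%N d (leq_subr _ _); rewrite -kE => /(_ fd) h1 h2.
have e : d = k by lia.
by rewrite e in fd.
Qed.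

(** This is transitivity of SL_n on complete flags. The vectors added at the successive steps are
    the rows of an invertible matrix b adapted to the chain. *)
Lemma chain_coord (V : nat -> subset_of R n) : (0 < n)%N ->
  (forall k, (k <= n)%N -> framed k (V k)) ->
  (forall k x, (k < n)%N -> V k x -> V k.+1 x) ->
  exists2 g, \det g = 1 & forall k, (k <= n)%N -> V k = coordsub k g.
Proof.
move=> n0 fV sV.
have /fin_all_exists[r rP] (k : 'I_n) : exists r, forall x,
    V k.+1 x <-> exists t, V k (x - t *: r).
  by apply: framed_step (fV _ (ltnW (ltn_ord k))) (fV _ (ltn_ord k)) _ => x; apply: sV.
pose b := \matrix_i r i.
have Vb k x : (k <= n)%N ->
    V k x <-> exists c : 'rV_n, (forall j : 'I_n, (k <= j)%N -> c 0 j = 0) /\ x = c *m b.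
  elim: k x => [|k IH] x kn.
    have [B [C [_ VB]]] := fV 0 kn; rewrite VB; split=> [[c ->]|[c [c0 ->]]].
      by exists 0; split=> [j _|]; rewrite ?mxE // mul0mx [B]flatmx0 mulmx0.
    by exists 0; rewrite (_ : c = 0) ?mul0mx //; apply/rowP => j; rewrite c0 ?mxE.
  rewrite (rP (Ordinal kn)) /=; split=> [[t /(IH _ (ltnW kn))[c [c0 xE]]]|[c [c0 ->]]].
    exists (c + t *: delta_mx 0 (Ordinal kn)); split=> [j kj|].
      rewrite !mxE c0 ?(ltnW kj) // add0r; case: (j =P Ordinal kn) => [e|_]; rewrite ?andbF ?mulr0 //.
      by rewrite e /= ltnn in kj.
    by rewrite mulmxDl -xE -scalemxAl -rowE rowK subrK.
  exists (c 0 (Ordinal kn)); apply/(IH _ (ltnW kn)).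
  exists (c - c 0 (Ordinal kn) *: delta_mx 0 (Ordinal kn)); split=> [j kj|].
    rewrite !mxE /=; case: (j =P Ordinal kn) => [->|jk].
      by rewrite mulr1 subrr.
    rewrite ?andbF mulr0 subr0.
    apply: c0; rewrite ltn_neqAle kj andbT; apply/eqP => e; apply: jk.
    exact: val_inj.
  by rewrite mulmxBl -scalemxAl -rowE rowK.
have full x : V n x.
  have [B [C [BC VB]]] := fV n (leqnn n); apply/VB; exists (x *m C).
  by rewrite -mulmxA (mulmx1C BC) mulmx1.
have /fin_all_exists[c cP] (i : 'I_n) : exists c : 'rV[R]_n, delta_mx 0 i = c *m b.
  by have /(Vb _ _ (leqnn n))[c [_ ->]] := full (delta_mx 0 i); exists c.
pose h := \matrix_i c i.
have hb : h *m b = 1%:M by apply/row_matrixP => i; rewrite row_mul rowK -cP row1.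
have bh := mulmx1C hb.
have uv : \det h * \det b = 1 by rewrite -det_mulmx hb det1.
have vu : \det b * \det h = 1 by rewrite mulrC.
pose i0 := Ordinal n0.
(* Scaling row 0 of b by the inverse of its determinant gives determinant 1 and changes none of the
   spans. *)
pose D u : 'M[R]_n := diag_mx (\row_j (if j == i0 then u else 1)).
have detD u : \det (D u) = u.
  rewrite det_diag (bigD1 i0) //= mxE eqxx big1 ?mulr1 // => j /negPf jE.
  by rewrite mxE jE.
have DD u v : u * v = 1 -> D u *m D v = 1%:M.
  move=> e; rewrite /D mul_diag_mx; apply/matrixP => i j; rewrite !mxE.
  case: (i == j); rewrite ?mulr0n ?mulr0 ?mulr1n //.
  by case: (i == i0); rewrite ?mulr1.
have dg : \det (D (\det h) *m b) = 1 by rewrite det_mulmx detD.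
exists (D (\det h) *m b) => // k kn.
have -> : coordsub k (D (\det h) *m b) =
    fun x => forall j : 'I_n, (k <= j)%N -> (x *m (h *m D (\det b))) 0 j = 0.
  rewrite /coordsub (adj_unique dg (h := h *m D (\det b))) //.
  by rewrite mulmxA -(mulmxA _ b) bh mulmx1 DD.
apply/funext => x; apply/propext; rewrite (Vb _ _ kn).
have xE j : (x *m (h *m D (\det b))) 0 j = (x *m h) 0 j * (if j == i0 then \det b else 1).
  by rewrite mulmxA mul_mx_diag !mxE.
split=> [[d [d0 xd]] j kj|x0].
  by rewrite xE xd -mulmxA bh mulmx1 d0 // mul0r.
exists (x *m h); split=> [j kj|]; last by rewrite -mulmxA hb mulmx1.
have := x0 j kj; rewrite xE; case: eqP => _; rewrite ?mulr1 //.
by move=> /(congr1 ( *%R^~ (\det h))); rewrite -mulrA vu mulr1 mul0r.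
Qed.

(** A complete flag containing the simplex is a translate of the standard one; uniqueness of rank
    turns [rank_le] into the bound k <= m. *)
Lemma simplex_coord m S : (0 < n)%N -> tits_simplex m S ->
  exists2 g, \det g = 1 &
    forall V, in_list V S -> exists2 k, (0 < k <= m)%N & V = coordsub k g.
Proof.
move=> n0 [SP [F [[Fsf [Fmono [F0 F1]]] SF]]].
(* The flag is padded with 0 at index 0 and with R^n from index n on. *)
pose V k : subset_of R n := match k with
  | 0 => fun x => x = 0
  | k'.+1 => if insub k' is Some i then F i else fun=> True end.
have VF (i : 'I_n.-1) : V i.+1 = F i by rewrite /= valK.
have Vn : V n = fun=> True.
  have VnE k : k = n -> V k = fun=> True.
    by case: k => [|k] kn; [lia|rewrite /= insubF //; lia].
  exact: VnE.
have Vmono k x : (k < n)%N -> V k x -> V k.+1 x.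
  case: (ltngtP k.+1 n) => // [lt_kn _|-> _ _]; last by rewrite Vn.
  have lk : (k < n.-1)%N by lia.
  rewrite -[k.+1]/(Ordinal lk).+1 VF; case: k lk {lt_kn} => [|k] lk.
    by move=> -> ; have [[[]]] := Fsf (Ordinal lk).
  have lk' : (k < n.-1)%N by lia.
  rewrite -[k.+1]/(Ordinal lk').+1 VF.
  by have [] := Fmono (Ordinal lk') (Ordinal lk) (ltnSn k) => H _; apply: H.
have Vstrict k : (k < n)%N -> exists x, V k.+1 x /\ ~ V k x.
  case: (ltngtP k.+1 n) => // [lt_kn _|kn _].
    have lk : (k < n.-1)%N by lia.
    rewrite -[k.+1]/(Ordinal lk).+1 VF; case: k lk {lt_kn} => [|k] lk; first exact: F0.
    have lk' : (k < n.-1)%N by lia.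
    rewrite -[k.+1]/(Ordinal lk').+1 VF.
    by have [] := Fmono (Ordinal lk') (Ordinal lk) (ltnSn k).
  rewrite kn Vn; case: k kn => [|k] kn.
    exists (const_mx 1); split => // /rowP/(_ (Ordinal n0)).
    by rewrite !mxE; apply/eqP; rewrite oner_eq0.
  have lk : (k < n.-1)%N by lia.
  rewrite -[k.+1]/(Ordinal lk).+1 VF.
  by have [x nFx] := F1 (Ordinal lk); exists x.
have Vframed k : (k <= n)%N -> exists d, framed d (V k).
  case: k => [|k] kn.
    exists 0, 0, 0; split; first by rewrite mulmx0 [1%:M]flatmx0.
    by move=> x; split=> [->|[c ->]]; rewrite ?mulmx0 //; exists 0; rewrite mulmx0.
  case: (ltngtP k.+1 n) kn => // [lt_kn _|-> _].
    have lk : (k < n.-1)%N by lia.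
    rewrite -[k.+1]/(Ordinal lk).+1 VF.
    have [ds [_ [d [b bP]]]] := Fsf (Ordinal lk).
    by exists d; apply: summand_framed bP.
  exists n, 1%:M, 1%:M; split; first by rewrite mulmx1.
  by rewrite Vn => x; split=> // _; exists x; rewrite mulmx1.
have fV := chain_framed Vframed Vmono Vstrict.
have [g dg gV] := chain_coord n0 fV Vmono.
exists g => // U SU; have [i UE] := SF U SU; have [[ds _] [k [b [km bP]]]] := SP U SU.
have lt_in : (i.+1 <= n)%N by have := ltn_ord i; lia.
exists i.+1; last by rewrite UE -VF gV.
have := framed_unique (summand_framed ds bP); rewrite UE -VF => /(_ _ (fV _ lt_in)).
by move=> e; lia.
Qed.
End CoordinateSubmodules.

(** * Edge paths and galleries *)

Section EdgePaths.
Variables (T : Type) (Simp : seq T -> Prop).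
Local Notation eqv := (ep_equiv Simp).

Lemma ep_ctx l r p q : eqv p q -> eqv (l ++ p ++ r) (l ++ q ++ r).
Proof.
elim=> {p q}.
- by move=> p; apply: ep_refl.
- by move=> p q _; apply: ep_sym.
- by move=> p q s _ pq _; apply: ep_trans.
- move=> p q u uS; have := ep_stutter (l ++ p) (q ++ r) uS.
  by rewrite -!catA.
move=> p q u v w uS; have := ep_move (l ++ p) (q ++ r) uS.
by rewrite -!catA.
Qed.

Lemma ep_catl l p q : eqv p q -> eqv (l ++ p) (l ++ q).
Proof. by move=> /(ep_ctx l [::]); rewrite !cats0. Qed.

Lemma ep_cons u p q : eqv p q -> eqv (u :: p) (u :: q).
Proof. exact: (@ep_catl [:: u]). Qed.

Lemma ep_catr r p q : eqv p q -> eqv (p ++ r) (q ++ r).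
Proof. exact: (@ep_ctx [::]). Qed.

Lemma ep_stutter_hd u r : Simp [:: u] -> eqv (u :: u :: r) (u :: r).
Proof. exact: (@ep_stutter _ _ [::] r). Qed.

Lemma ep_move_hd u v w r : Simp [:: u; v; w] -> eqv (u :: v :: w :: r) (u :: w :: r).
Proof. exact: (@ep_move _ _ [::] r). Qed.

Lemma edge_path_cat u p q : edge_path Simp (u :: p) ->
  edge_path Simp (last u p :: q) -> edge_path Simp (u :: p ++ q).
Proof. by elim: p u => [|v p IH] u //= [uv pP] qP; split=> //; apply: IH. Qed.

Hypothesis simp1 : forall u v, Simp [:: u; v] -> Simp [:: u].
Hypothesis simp_back : forall u v, Simp [:: u; v] -> Simp [:: u; v; u].

Lemma ep_backtrack u p : edge_path Simp (u :: p) ->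
  eqv (u :: p ++ rev (belast u p)) [:: u].
Proof.
elim: p u => [|v p IH] u /=; first by move=> _; apply: ep_refl.
case=> uv /IH vp; rewrite rev_cons -cats1 catA -[u :: _]/(u :: (v :: _ ++ _) ++ _).
apply: ep_trans (ep_ctx [:: u] [:: u] vp) _.
apply: ep_trans (ep_move_hd [::] (simp_back uv)) _.
exact: ep_stutter_hd (simp1 uv).
Qed.

(** Appending the reverse of q to both sides cancels q. Loops at any vertex can thus be studied
    through paths ending at the base vertex. *)
Lemma ep_loop_cancel u p q : edge_path Simp (u :: q) -> last u p = u ->
  eqv (u :: p ++ q) (u :: q) -> eqv (u :: p) [:: u].
Proof.
move=> qP pu pq; have uq := ep_backtrack qP.
have e : u :: p = belast u p ++ [:: u] by rewrite lastI pu cats1.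
apply: ep_trans uq; apply: ep_trans (ep_catr (rev (belast u q)) pq).
rewrite -[u :: p ++ q]/((u :: p) ++ q) -catA e -catA.
exact/ep_catl/ep_sym/ep_backtrack.
Qed.
End EdgePaths.

(** * Galleries: edge paths read off from words in the parabolics *)

Section Galleries.
Variables (R : comNzRingType) (n m : nat).
Hypothesis ltmn : (m < n)%N.
Local Notation S := (@tits_simplex R n m).
Local Notation eqv := (ep_equiv S).
Implicit Types g h : 'M[R]_n.

Lemma simplex_sub s s' : (forall V, in_list V s' -> in_list V s) -> S s -> S s'.
Proof.
move=> ss' [sP [F [FP sF]]]; split; first by move=> V /ss'/sP.
by exists F; split=> // V /ss'/sF.
Qed.

Lemma coord_simplex3 a b c g : \det g = 1 -> (0 < a <= m)%N -> (0 < b <= m)%N ->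
  (0 < c <= m)%N -> S [:: coordsub a g; coordsub b g; coordsub c g].
Proof.
move=> dg am bm cm; have := @coord_simplex R n m g [:: a; b; c] ltmn dg; apply.
by rewrite /= am bm cm.
Qed.

Lemma coord_simplex2 a b g : \det g = 1 -> (0 < a <= m)%N -> (0 < b <= m)%N ->
  S [:: coordsub a g; coordsub b g].
Proof.
move=> dg am bm; have := @coord_simplex R n m g [:: a; b] ltmn dg; apply.
by rewrite /= am bm.
Qed.

Lemma coord_simplex1 a g : \det g = 1 -> (0 < a <= m)%N -> S [:: coordsub a g].
Proof.
move=> dg am; have := @coord_simplex R n m g [:: a] ltmn dg; apply.
by rewrite /= am.
Qed.

Definition is_step (a : nat * 'M[R]_n) := (0 < a.1 <= m)%N && parabolic a.1 a.2.
Definition step := {a : nat * 'M[R]_n | is_step a}.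
Implicit Types (a : step) (w : seq step).

Definition srank a := (val a).1.
Definition smx a := (val a).2.

Lemma srankP a : (0 < srank a <= m)%N.
Proof. by have /andP[] := valP a. Qed.

Lemma smxP a : parabolic (srank a) (smx a).
Proof. by have /andP[] := valP a. Qed.

Lemma m_gt0 a : (0 < 1 <= m)%N.
Proof. by have := srankP a; lia. Qed.

Definition steps_mx w : 'M[R]_n := foldr (fun a g => smx a *m g) 1%:M w.

Lemma det_steps_mx w : \det (steps_mx w) = 1.
Proof.
elim: w => [|a w IH] /=; first exact: det1.
by rewrite det_mulmx IH (parabolic_det (smxP a)) mulr1.
Qed.

Lemma steps_mx_cat w w' : steps_mx (w ++ w') = steps_mx w *m steps_mx w'.
Proof. by elim: w => [|a w IH] /=; rewrite ?mul1mx // IH mulmxA. Qed.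

(* A word of steps w describes an edge path from the translate by
   [steps_mx w *m g] of the base vertex to its translate by g; the last vertex
   is left out. *)
Fixpoint gallery g w : seq (subset_of R n) :=
  if w is a :: w' then
    coordsub 1 (steps_mx w *m g) :: coordsub (srank a) (steps_mx w' *m g) :: gallery g w'
  else [::].

Definition full_gallery g w := gallery g w ++ [:: coordsub 1 g].

Lemma full_gallery_cons g a w : full_gallery g (a :: w) =
  coordsub 1 (steps_mx (a :: w) *m g) ::
  coordsub (srank a) (steps_mx w *m g) :: full_gallery g w.
Proof. by []. Qed.

Lemma gallery_cat g w w' :
  gallery g (w ++ w') = gallery (steps_mx w' *m g) w ++ gallery g w'.
Proof. by elim: w => //= a w ->; rewrite steps_mx_cat !mulmxA. Qed.

Lemma gallery_head g w s :
  exists s', gallery g w ++ coordsub 1 g :: s = coordsub 1 (steps_mx w *m g) :: s'.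
Proof. by case: w => [|a w] /=; rewrite ?mul1mx; [exists s|eexists]. Qed.

(** A step a in P_k fixes the vertex of rank k, which is therefore joined to the rank one vertices
    of both translates. *)
Lemma edge_path_gallery g w s : \det g = 1 -> edge_path S (coordsub 1 g :: s) ->
  edge_path S (gallery g w ++ coordsub 1 g :: s).
Proof.
move=> dg sP; elim: w => //= a w; have [s' ->] := gallery_head g w s => s'P.
have dwg : \det (steps_mx w *m g) = 1 by rewrite det_mulmx det_steps_mx dg mulr1.
split; last split=> //.
  rewrite -(coord_parabolic (smxP a) dwg) mulmxA.
  apply: coord_simplex2 (m_gt0 a) (srankP a).
  by rewrite -mulmxA det_mulmx dwg (parabolic_det (smxP a)) mulr1.
exact: coord_simplex2 (srankP a) (m_gt0 a).
Qed.

(** Quantifying over g makes this a congruence: in [w1 ++ w2] the gallery of w1 starts from the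
    translate by the matrix of w2. Equality of matrices keeps the starting vertices equal and gives
    the group of classes a map to SL_n. *)
Definition homotopic w w' := steps_mx w = steps_mx w' /\
  forall g, \det g = 1 -> eqv (full_gallery g w) (full_gallery g w').

Lemma homotopic_refl w : homotopic w w.
Proof. by split=> // g _; apply: ep_refl. Qed.

Lemma homotopic_sym w w' : homotopic w w' -> homotopic w' w.
Proof. by case=> e H; split=> // g dg; apply/ep_sym/H. Qed.

Lemma homotopic_trans w1 w2 w3 :
  homotopic w1 w2 -> homotopic w2 w3 -> homotopic w1 w3.
Proof.
case=> e H [e' H']; split; first exact: etrans e'.
by move=> g dg; apply: ep_trans (H g dg) (H' g dg).
Qed.

Lemma homotopic_cat w1 w2 w1' w2' : homotopic w1 w1' -> homotopic w2 w2' ->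
  homotopic (w1 ++ w2) (w1' ++ w2').
Proof.
case=> e1 H1 [e2 H2]; apply: (@homotopic_trans _ (w1' ++ w2)).
  split=> [|g dg]; first by rewrite !steps_mx_cat e1.
  rewrite /full_gallery !gallery_cat -!catA.
  have [s ->] := gallery_head g w2 [::]; rewrite -cat1s !catA; apply: ep_catr.
  by apply: H1; rewrite det_mulmx det_steps_mx dg mulr1.
split=> [|g dg]; first by rewrite !steps_mx_cat e2.
by rewrite /full_gallery !gallery_cat -!catA e2; apply/ep_catl/H2.
Qed.

Lemma step_proof k g : (0 < k <= m)%N -> parabolic k g -> is_step (k, g).
Proof. by rewrite /is_step => -> /= ->. Qed.

Definition mk_step k g (km : (0 < k <= m)%N) (kg : parabolic k g) : step :=
  Sub (k, g) (step_proof km kg).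

(** Both steps pass through the same vertex of rank k, so the rank one vertex between them is a
    spur. *)
Lemma homotopic_step_mul a b c : srank a = srank b -> srank c = srank b ->
  smx c = smx a *m smx b -> homotopic [:: a; b] [:: c].
Proof.
move=> ab cb cE; split=> [|g dg]; first by rewrite /= cE !mulmxA.
rewrite /full_gallery /= cE !mulmx1 !mul1mx ab cb -!mulmxA; apply: ep_cons.
have dbg : \det (smx b *m g) = 1.
  by rewrite det_mulmx (parabolic_det (smxP b)) dg mulr1.
have e := coord_parabolic (smxP b) dg; have m1 := m_gt0 b; have bm := srankP b.
rewrite e; apply: ep_trans (ep_stutter_hd _ (coord_simplex1 dg bm)).
by apply: ep_move_hd; rewrite -e; apply: coord_simplex3.
Qed.

(** The matrix fixes both vertices of ranks k and k', so the edge between them spans a simplex with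
    each of the two rank one ends. This is the amalgamation relation on an intersection. *)
Lemma homotopic_step_rank a b : smx a = smx b -> homotopic [:: a] [:: b].
Proof.
move=> ab; split=> [|g dg]; first by rewrite /= ab.
have m1 := m_gt0 b; have am := srankP a; have bm := srankP b.
have dag : \det (smx a *m g) = 1.
  by rewrite det_mulmx (parabolic_det (smxP a)) dg mulr1.
rewrite /full_gallery /= !mulmx1 !mul1mx -ab.
apply: (@ep_trans _ _ _ [:: coordsub 1 (smx a *m g); coordsub (srank a) g;
  coordsub (srank b) g; coordsub 1 g]).
  by apply/ep_sym/ep_cons/ep_move_hd/coord_simplex3.
apply: ep_move_hd; rewrite -(coord_parabolic (smxP a) dg).
have -> : coordsub (srank b) g = coordsub (srank b) (smx a *m g).
  by rewrite ab (coord_parabolic (smxP b) dg).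
exact: coord_simplex3.
Qed.

Lemma homotopic_step1 a : smx a = 1%:M -> homotopic [:: a] [::].
Proof.
move=> a1; split=> [|g dg]; first by rewrite /= a1 mulmx1.
have m1 := m_gt0 a; have am := srankP a.
rewrite /full_gallery /= a1 !mul1mx.
apply: ep_trans (ep_move_hd _ (coord_simplex3 dg m1 am m1)) _.
exact: ep_stutter_hd (coord_simplex1 dg m1).
Qed.

Definition step_inv a : step :=
  mk_step (srankP a) (parabolicV (smxP a)).

Definition steps_inv w := rev (map step_inv w).

Lemma homotopic_step_mulV a : homotopic [:: step_inv a; a] [::].
Proof.
apply: homotopic_trans (@homotopic_step1 (mk_step (srankP a) (parabolic1 _ _ _)) erefl).
by apply: homotopic_step_mul => //=; rewrite mul_adjV // (parabolic_det (smxP a)).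
Qed.

Lemma homotopic_step_mulVr a : homotopic [:: a; step_inv a] [::].
Proof.
apply: homotopic_trans (@homotopic_step1 (mk_step (srankP a) (parabolic1 _ _ _)) erefl).
by apply: homotopic_step_mul => //=; rewrite mul_mxV // (parabolic_det (smxP a)).
Qed.

Lemma homotopic_mulV w : homotopic (steps_inv w ++ w) [::].
Proof.
elim: w => [|a w IH]; first exact: homotopic_refl.
have -> : steps_inv (a :: w) ++ a :: w = steps_inv w ++ ([:: step_inv a; a] ++ w).
  by rewrite /steps_inv /= rev_cons cat_rcons.
apply: homotopic_trans IH; apply: homotopic_cat; first exact: homotopic_refl.
exact: homotopic_cat (homotopic_step_mulV a) (homotopic_refl w).
Qed.

Lemma homotopic_mulVr w : homotopic (w ++ steps_inv w) [::].
Proof.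
elim: w => [|a w IH]; first exact: homotopic_refl.
have -> : (a :: w) ++ steps_inv (a :: w) =
    [:: a] ++ (w ++ steps_inv w) ++ [:: step_inv a].
  by rewrite /steps_inv /= rev_cons -cats1 catA.
apply: homotopic_trans (homotopic_step_mulVr a).
rewrite -[[:: a; _]]/([:: a] ++ [::] ++ [:: _]).
apply: homotopic_cat; first exact: homotopic_refl.
exact: homotopic_cat IH (homotopic_refl _).
Qed.

Definition homotopicb w w' := `[< homotopic w w' >].

Lemma homotopicb_refl : reflexive homotopicb.
Proof. by move=> w; apply/asboolP/homotopic_refl. Qed.

Lemma homotopicb_sym : symmetric homotopicb.
Proof. by move=> w w'; apply/asboolP/asboolP; apply: homotopic_sym. Qed.

Lemma homotopicb_trans : transitive homotopicb.
Proof.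
by move=> w w1 w2 /asboolP H /asboolP H'; apply/asboolP/(homotopic_trans H).
Qed.

Canonical homotopic_equiv :=
  EquivRel homotopicb homotopicb_refl homotopicb_sym homotopicb_trans.
End Galleries.

(** * The group of galleries and its map to SL_n *)

Section GalleryGroup.
Variables (R : comNzRingType) (n m : nat).
Hypothesis ltmn : (m < n)%N.
Local Open Scope quotient_scope.

(* The group law below needs m < n, so the carrier is indexed by a proof of it. *)
Definition gallery_group of (m < n)%N := {eq_quot @homotopic_equiv R n m}.
Local Notation G := (gallery_group ltmn).

HB.instance Definition _ := Choice.on G.

Definition gclass (w : seq (step R n m)) : G := \pi_({eq_quot @homotopic_equiv R n m}) w.
Definition grepr (x : G) : seq (step R n m) := repr (x : {eq_quot @homotopic_equiv R n m}).

Lemma greprK x : gclass (grepr x) = x.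
Proof. exact: reprK. Qed.

Lemma gclassP w w' : gclass w = gclass w' <-> homotopic w w'.
Proof.
have -> : homotopic w w' <-> @homotopic_equiv R n m w w' by exact: (rwP (asboolP _)).
by split=> [e|H]; [apply/eqmodP|apply/eqmodP].
Qed.

Lemma grepr_class w : homotopic (grepr (gclass w)) w.
Proof. by apply/gclassP; rewrite greprK. Qed.

Definition gmul (x y : G) : G := gclass (grepr x ++ grepr y).
Definition ginv (x : G) : G := gclass (steps_inv (grepr x)).

Lemma gclass_cat w w' : gmul (gclass w) (gclass w') = gclass (w ++ w').
Proof. by apply/gclassP/homotopic_cat; apply: grepr_class. Qed.

Fact gmulA : associative gmul.
Proof.
move=> x y z; rewrite -(greprK x) -(greprK y) -(greprK z).
by rewrite !gclass_cat catA.
Qed.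

Fact gmul1g : left_id (gclass [::]) gmul.
Proof. by move=> x; rewrite -(greprK x) gclass_cat. Qed.

Fact gmulg1 : right_id (gclass [::]) gmul.
Proof. by move=> x; rewrite -(greprK x) gclass_cat cats0. Qed.

Fact gmulVg : left_inverse (gclass [::]) ginv gmul.
Proof.
move=> x; rewrite -[X in gmul _ X]greprK gclass_cat.
exact/gclassP/homotopic_mulV.
Qed.

Fact gmulgV : right_inverse (gclass [::]) ginv gmul.
Proof.
move=> x; rewrite -[X in gmul X _]greprK gclass_cat.
exact/gclassP/homotopic_mulVr.
Qed.

HB.instance Definition _ := isGroup.Build G gmulA gmul1g gmulg1 gmulVg gmulgV.

(** The value 1 is a default for pairs that are not steps. *)
Definition ggen k g : G := if insub (k, g) is Some a then gclass [:: a] else 1%g.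

Lemma ggenE k g (km : (0 < k <= m)%N) (kg : parabolic k g) :
  ggen k g = gclass [:: mk_step km kg].
Proof.
by rewrite /ggen; have := step_proof km kg => Hs; rewrite (insubT (@is_step R n m) Hs);
   congr (gclass [:: _]); apply: val_inj.
Qed.

Lemma ggen_step (a : step R n m) : ggen (srank a) (smx a) = gclass [:: a].
Proof.
rewrite (ggenE (srankP a) (smxP a)); congr (gclass [:: _]).
by apply: val_inj; case: a => [[]].
Qed.

Lemma ggenM k g h : (0 < k <= m)%N -> parabolic k g -> parabolic k h ->
  ggen k (g *m h) = (ggen k g * ggen k h)%g.
Proof.
move=> km kg kh; rewrite (ggenE km kg) (ggenE km kh) (ggenE km (parabolicM kg kh)).
rewrite [RHS]gclass_cat; apply/esym/gclassP.
by apply: homotopic_step_mul.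
Qed.

Lemma ggen_indep k k' g : (0 < k <= m)%N -> (0 < k' <= m)%N ->
  parabolic k g -> parabolic k' g -> ggen k g = ggen k' g.
Proof.
move=> km km' kg kg'; rewrite (ggenE km kg) (ggenE km' kg'); apply/gclassP.
exact: homotopic_step_rank.
Qed.

Definition gmx (x : G) := steps_mx (grepr x).

Lemma gmx_class w : gmx (gclass w) = steps_mx w.
Proof. by have [] := grepr_class w. Qed.

Lemma gmxM x y : gmx (x * y)%g = gmx x *m gmx y.
Proof. by rewrite [LHS]gmx_class steps_mx_cat. Qed.

Lemma gmx_gen k g : (0 < k <= m)%N -> parabolic k g -> gmx (ggen k g) = g.
Proof. by move=> km kg; rewrite (ggenE km kg) gmx_class /= mulmx1. Qed.

Hypothesis lt2m : (2 < m)%N.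
Hypothesis slE : SL_elementary R.
Hypothesis k2 : K2_3_surj R n.

Lemma gclass_word w : exists2 v, valid_word v & gclass w = word_elt ggen lt2m ltmn v.
Proof.
elim: w => [|a w [v vv e]]; first by exists [::].
have [u uv ue] := gen_word lt2m ltmn ggenM ggen_indep slE (srankP a) (smxP a).
exists (u ++ v); first by rewrite /valid_word all_cat; apply/andP.
by rewrite word_elt_cat -e -ue ggen_step [RHS]gclass_cat.
Qed.

Lemma gmx_inj : injective gmx.
Proof.
have inj1 x : gmx x = 1%:M -> x = 1%g.
  rewrite -(greprK x); have [v vv ->] := gclass_word (grepr x) => e.
  exact: (pr_word_inj ggenM ggen_indep gmxM gmx_gen k2 vv e).
move=> x y e; apply: divg1_eq; apply: inj1; rewrite gmxM e -gmxM mulgV.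
exact: gmx_class.
Qed.

Lemma steps_mx_inj (w w' : seq (step R n m)) : steps_mx w = steps_mx w' -> homotopic w w'.
Proof. by rewrite -!gmx_class => /gmx_inj/gclassP. Qed.

(** An elementary factor may be a far root and hence not a step; its class in the group of galleries
    still has a representing word with the right matrix. *)
Lemma ex_steps g : \det g = 1 -> exists w : seq (step R n m), steps_mx w = g.
Proof.
have n0 : (0 < n)%N by lia.
move=> dg; have [v [vv <-]] := slE n0 dg.
exists (grepr (word_elt ggen lt2m ltmn v)).
exact: (pr_word lt2m ltmn ggenM ggen_indep gmxM gmx_gen vv).
Qed.

(** * From galleries to simple connectivity *)

Local Notation S := (@tits_simplex R n m).
Local Notation eqv := (ep_equiv S).

(** Induction from the end of the path. An edge u, v lies in some translate by g; inserting its rank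
    one vertex between u and v adds a step, namely g times the inverse of the matrix so far, which
    fixes v. The first vertex has any rank and is kept in front. *)
Lemma edge_path_gallery_form u p : edge_path S (u :: p) ->
  last u p = coordsub 1 1%:M -> exists k (w : seq (step R n m)),
  [/\ (0 < k <= m)%N, u = coordsub k (steps_mx w) &
      eqv (u :: p) (coordsub k (steps_mx w) :: full_gallery 1%:M w)].
Proof.
have m1 : (0 < 1 <= m)%N by lia.
have n0 : (0 < n)%N by lia.
elim: p u => [|v p IH] u.
  move=> _ /= ->; exists 1, [::]; split=> //.
  by apply/ep_sym/ep_stutter_hd/coord_simplex1; rewrite ?det1.
move=> [uv vP] vE; have {IH}[k [w [km ve IH]]] := IH v vP vE.
have [g dg gP] := simplex_coord n0 uv.
have [|a am ue] := gP u; first by left.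
have [|b bm ve'] := gP v; first by right; left.
have dw := det_steps_mx w.
have bk : b = k by apply: (@coord_eq_rank _ _ b k g (steps_mx w)); rewrite -?ve -?ve' //; lia.
subst b; have kh : parabolic k (g *m \adj (steps_mx w)).
  by apply: coord_eq_parabolic; rewrite // -ve -ve'.
pose s := mk_step km kh.
have sE : steps_mx (s :: w) = g by rewrite /= -mulmxA mul_adjV // mulmx1.
exists a, (s :: w); rewrite sE ue; split=> //.
rewrite full_gallery_cons sE !mulmx1.
apply: (@ep_trans _ _ _ (coordsub a g :: v :: full_gallery 1%:M w)).
  by apply: ep_cons; rewrite [v in v :: full_gallery _ _]ve.
rewrite -ve; apply/ep_sym/ep_move_hd; rewrite ve'.
exact: coord_simplex3.
Qed.

Lemma vertex_coord v : is_vertex S v ->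
  exists2 k, (0 < k <= m)%N & exists2 g, \det g = 1 & v = coordsub k g.
Proof.
have n0 : (0 < n)%N by lia.
move=> /(simplex_coord n0)[g dg gP]; have [|k km ->] := gP v; first by left.
by exists k => //; exists g.
Qed.

Lemma ex_edge_path u v : is_vertex S u -> is_vertex S v ->
  exists p, edge_path S (u :: p) /\ last u p = v.
Proof.
have m1 : (0 < 1 <= m)%N by lia.
move=> /vertex_coord[k km [g dg ->]] /vertex_coord[k' km' [g' dg' ->]].
have [|w wE] := @ex_steps (g *m \adj g').
  by rewrite det_mulmx dg det_adj1 // mulr1.
have tail : edge_path S [:: coordsub 1 g'; coordsub k' g'].
  by split; [apply: coord_simplex2|apply: coord_simplex1].
exists (gallery g' w ++ [:: coordsub 1 g'; coordsub k' g']).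
split; last by rewrite last_cat.
have := edge_path_gallery ltmn w dg' tail.
have [s ->] := gallery_head g' w [:: coordsub k' g'].
rewrite wE -mulmxA mul_adjV // mulmx1 => sP.
by split=> //; apply: coord_simplex2.
Qed.

Lemma null_homotopic_loop v p :
  edge_path S (v :: p) -> last v p = v -> eqv (v :: p) [:: v].
Proof.
have m1 : (0 < 1 <= m)%N by lia.
move=> pP pv.
have v_vertex : is_vertex S v.
  case: p pP {pv} => [//|u p [vu _]].
  by apply: simplex_sub vu => V [->|//]; left.
have o_vertex : is_vertex S (coordsub 1 1%:M : subset_of R n).
  by apply: coord_simplex1; rewrite ?det1.
(* The loop followed by a path q to the base vertex is compared with q alone. *)
have [q [qP qo]] := ex_edge_path v_vertex o_vertex.
have pqP : edge_path S (v :: p ++ q) by apply: edge_path_cat => //; rewrite pv.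
have pqo : last v (p ++ q) = coordsub 1 1%:M by rewrite last_cat pv.
apply: (ep_loop_cancel _ _ qP pv).
- by move=> x y; apply: simplex_sub => V [->|//]; left.
- move=> x y; apply: simplex_sub => V [->|[->|[->|//]]];
    by [left|right; left|left].
have [k [w [km vE pqE]]] := edge_path_gallery_form pqP pqo.
have [k' [w' [km' vE' qE]]] := edge_path_gallery_form qP qo.
have [dw dw'] := (det_steps_mx w, det_steps_mx w').
have kk' : k = k'.
  by apply: (@coord_eq_rank _ _ k k' (steps_mx w) (steps_mx w')); rewrite -?vE -?vE' //; lia.
subst k'; have kh : parabolic k (steps_mx w *m \adj (steps_mx w')).
  by apply: coord_eq_parabolic; rewrite // -vE -vE'.
(* Both words send the base to the same vertex v of rank k, so their matrices differ by an element
   of P_k; prefixing it to w' makes the matrices equal, hence the words homotopic. *)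
pose s := mk_step km kh.
have sE : steps_mx (s :: w') = steps_mx w by rewrite /= -mulmxA mul_adjV // mulmx1.
apply: ep_trans pqE _; apply: ep_trans (ep_sym qE).
have [_ H] := steps_mx_inj (esym sE).
apply: ep_trans (ep_cons _ (H _ (det1 _ _))) _.
rewrite full_gallery_cons sE !mulmx1.
(* The prefixed step only leaves v for a rank one neighbour and returns, a spur that is removed. *)
rewrite -vE -vE'; have vw : S [:: v; coordsub 1 (steps_mx w); v].
  by rewrite vE; apply: coord_simplex3.
apply: ep_trans (ep_move_hd _ vw) _.
exact: ep_stutter_hd.
Qed.
End GalleryGroup.

Theorem mainTheorem13 (R : comNzRingType) (n m : nat) :
  (3 <= m)%N -> (m < n)%N ->
  SL_elementary R -> K2_3_surj R n ->
  simply_connected (@tits_simplex R n m).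
Proof.
move=> lt2m ltmn slE k2; split; last split.
- exists (coordsub 1 1%:M); apply: coord_simplex1; rewrite ?det1 //.
  exact: ltnW (ltnW lt2m).
- exact: (ex_edge_path ltmn lt2m slE).
exact: (null_homotopic_loop ltmn lt2m slE k2).
Qed.
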